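(* Let $\gamma>0$, let $\{\xi(z):z\in\mathbb{Z}^d\}$ be i.i.d. Weibull($\gamma$) random variables, and let $Z_t^{(1)}$ be a maximiser over $z\in\mathbb{Z}^d$ of $\Psi_t(z)=\xi(z)-\frac{|z|}{\gamma t}\log\log t$. Let $$r_t=\frac{t(\log t)^{1/\gamma-1}}{\log\log t}.$$ Then, as $t\to\infty$, $Z_t^{(1)}/r_t$ converges in distribution to an $\mathbb{R}^d$-valued random variable $X^{(1)}$ with independent coordinates whose absolute values are exponentially distributed with parameter $d^{1-1/\gamma}$ and whose signs are uniform random signs, that is, with density $$p^{(1)}(x)=\frac{d^{d(1-1/\gamma)}}{2^d}\exp\bigl\{-d^{1-1/\gamma}|x|\bigr\},\qquad x\in\mathbb{R}^d.$$
   Context: $d\ge1$ is an integer and $|\cdot|$ is the $\ell^1$-norm. The $\xi(z)$ are independent with $\mathrm{Prob}\{\xi(z)<x\}=1-e^{-x^{\gamma}}$ for $x\ge0$. $\Psi_t$ is defined for all $t$ large enough that $\log\log t$ is well defined and positive; for such $t$ a maximiser $Z_t^{(1)}$ exists almost surely (if there are several, any choice is made). *)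

(* Defs.v *)
From HB Require Import structures.
From mathcomp Require Import all_boot all_order all_algebra.
From mathcomp Require Import all_classical all_reals all_analysis.

Set Implicit Arguments.
Unset Strict Implicit.
Unset Printing Implicit Defensive.

Import Order.TTheory GRing.Theory Num.Theory.
Import numFieldNormedType.Exports.

Local Open Scope classical_set_scope.
Local Open Scope ring_scope.

Definition row_display : measure_display -> measure_display.
Proof. exact. Qed.

(* The product sigma-algebra on row vectors, generated by the coordinates; on
   ['rV[R]_n] it is the Borel sigma-algebra. *)
Section measurable_row.
Context {d} {T : sigmaRingType d}.
Variable n : nat.

Let coord : 'I_n -> 'rV[T]_n -> T := fun i x => x ord0 i.

Let row_set0 : g_sigma_preimage coord set0.
Proof. exact: sigma_algebra0. Qed.

Let row_setC A : g_sigma_preimage coord A -> g_sigma_preimage coord (~` A).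
Proof. exact: sigma_algebraC. Qed.

Let row_bigcup (F : _^nat) : (forall i, g_sigma_preimage coord (F i)) ->
  g_sigma_preimage coord (\bigcup_i (F i)).
Proof. exact: sigma_algebra_bigcup. Qed.

HB.instance Definition _ := @isMeasurable.Build (row_display d)
  'rV[T]_n (g_sigma_preimage coord) row_set0 row_setC row_bigcup.

End measurable_row.

Lemma measurable_coord d (T : sigmaRingType d) n (i : 'I_n) :
  measurable_fun [set: 'rV[T]_n] (fun x => x ord0 i).
Proof.
move=> _ Y mY; rewrite setTI; apply: sub_sigma_algebra => /=.
rewrite -bigcup_seq/=; exists i => /=; first by rewrite mem_index_enum.
by exists Y => //; rewrite setTI.
Qed.

Lemma measurable_fun_coordP d1 d2 (T1 : measurableType d1)
    (T2 : measurableType d2) n (f : T1 -> 'rV[T2]_n) :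
  measurable_fun [set: T1] f <->
  forall i, measurable_fun [set: T1] (fun w => f w ord0 i).
Proof.
split=> [mf i|mf].
  exact: (measurableT_comp (@measurable_coord _ _ _ i) mf).
apply: (@measurability _ _ _ _ _ _
  (\big[setU/set0]_(i < n) preimage_set_system setT
     (fun x : 'rV[T2]_n => x ord0 i) measurable)) => //.
move=> _ [B + <-]; rewrite -bigcup_seq => -[i _ [C mC <-]].
by rewrite !setTI; have := mf i measurableT C mC; rewrite setTI.
Qed.

Definition cons_row (R : realType) n (p : R * 'rV[R]_n) : 'rV[R]_n.+1 :=
  row_mx (p.1)%:M p.2.

Lemma cons_row0 (R : realType) n (p : R * 'rV[R]_n) : cons_row p ord0 ord0 = p.1.
Proof.
rewrite /cons_row (_ : ord0 = lshift n (ord0 : 'I_1)); last exact/val_inj.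
by rewrite (@row_mxEl _ 1 1 n) mxE eqxx.
Qed.

Lemma cons_rowS (R : realType) n (p : R * 'rV[R]_n) (i : 'I_n) :
  cons_row p ord0 (lift ord0 i) = p.2 ord0 i.
Proof.
rewrite /cons_row (_ : lift ord0 i = rshift 1 i); last exact/val_inj.
by rewrite (@row_mxEr _ 1 1 n).
Qed.

Lemma measurable_cons_row (R : realType) n :
  measurable_fun [set: R * 'rV[R]_n] (@cons_row R n).
Proof.
apply/measurable_fun_coordP => i.
case: (unliftP ord0 i) => [j ->|->].
  under eq_fun do rewrite cons_rowS.
  exact: (measurableT_comp (@measurable_coord _ _ _ j) measurable_snd).
by under eq_fun do rewrite cons_row0; exact: measurable_fst.
Qed.

Section lebesgue_cons.
Local Open Scope ereal_scope.
Context (R : realType) (n : nat).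
Variable m : {sigma_finite_measure set 'rV[R]_n -> \bar R}.

Definition lebesgue_cons : set 'rV[R]_n.+1 -> \bar R :=
  pushforward ((@lebesgue_measure R) \x m) (@cons_row R n).

Let lebesgue_cons0 : lebesgue_cons set0 = 0.
Proof. by rewrite /lebesgue_cons /pushforward preimage_set0 measure0. Qed.

Let lebesgue_cons_ge0 A : 0 <= lebesgue_cons A.
Proof. by rewrite /lebesgue_cons /pushforward measure_ge0. Qed.

Let measurable_preimage A : measurable A ->
  measurable (@cons_row R n @^-1` A).
Proof.
by move=> mA; rewrite -[X in measurable X]setTI; exact: measurable_cons_row.
Qed.

Let lebesgue_cons_sigma_additive : semi_sigma_additive lebesgue_cons.
Proof.
move=> F mF tF mUF; rewrite /lebesgue_cons /pushforward preimage_bigcup.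
apply: (@measure_semi_sigma_additive _ _ _ ((@lebesgue_measure R) \x m)).
- by move=> k; exact: measurable_preimage.
- apply/trivIsetP => /= i j _ _ ij; rewrite -preimage_setI.
  by move/trivIsetP : tF => /(_ _ _ _ _ ij) ->//; rewrite preimage_set0.
- by rewrite -preimage_bigcup; exact: measurable_preimage.
Qed.

HB.instance Definition _ := isMeasure.Build _ _ _ lebesgue_cons
  lebesgue_cons0 lebesgue_cons_ge0 lebesgue_cons_sigma_additive.

Let lebesgue_cons_sigma_finite : sigma_finite setT lebesgue_cons.
Proof.
have /sigma_finiteP[F [TF ndF Foo]] := sigma_finiteT (@lebesgue_measure R).
have /sigma_finiteP[G [TG ndG Goo]] := sigma_finiteT m.
pose tail (x : 'rV[R]_n.+1) : 'rV[R]_n := \row_i x ord0 (lift ord0 i).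
have mtail : measurable_fun [set: 'rV[R]_n.+1] tail.
  apply/measurable_fun_coordP => i.
  rewrite (_ : (fun _ => _) = fun x : 'rV[R]_n.+1 => x ord0 (lift ord0 i)).
    exact: measurable_coord.
  by apply/funext => x /=; rewrite mxE.
pose head (x : 'rV[R]_n.+1) : measurableTypeR R := x ord0 ord0.
have mhead : measurable_fun [set: 'rV[R]_n.+1] head by exact: measurable_coord.
exists (fun k => head @^-1` F k `&` tail @^-1` G k).
  apply/esym/seteqP; split=> // x _.
  have [k _ Fk] : (\bigcup_k F k) (head x) by rewrite -TF.
  have [l _ Gl] : (\bigcup_k G k) (tail x) by rewrite -TG.
  exists (maxn k l) => //; split => /=.
  - by move: Fk; exact/subsetPset/ndF/leq_maxl.
  - by move: Gl; exact/subsetPset/ndG/leq_maxr.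
move=> k; have [mF Fk] := Foo k; have [mG Gk] := Goo k; split.
  by apply: measurableI; rewrite -[X in measurable X]setTI;
    [exact: mhead|exact: mtail].
rewrite /lebesgue_cons /pushforward.
rewrite (_ : _ @^-1` _ = F k `*` G k); last first.
  apply/seteqP; split=> -[a x] /=; rewrite /head /tail cons_row0 (_ : \row_i _ = x) //;
    by apply/rowP => i; rewrite mxE cons_rowS.
by rewrite product_measure1E// lte_mul_pinfty// ge0_fin_numE.
Qed.

HB.instance Definition _ := Measure_isSigmaFinite.Build _ _ _ lebesgue_cons
  lebesgue_cons_sigma_finite.

End lebesgue_cons.

(* Lebesgue measure on R^n, as the n-fold product of [lebesgue_measure]. *)
Fixpoint lebesgue_row (R : realType) (n : nat) :
    {sigma_finite_measure set 'rV[R]_n -> \bar R} :=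
  match n with
  | 0 => dirac (0 : 'rV[R]_0)
  | n'.+1 => lebesgue_cons (lebesgue_row R n')
  end.

Lemma lebesgue_row_box (R : realType) (n : nat) (A : 'I_n -> set R) :
  (forall i, measurable (A i)) ->
  lebesgue_row R n [set x : 'rV[R]_n | forall i, A i (x ord0 i)] =
  (\prod_(i < n) lebesgue_measure (A i))%E.
Proof.
elim: n A => [|n IHn] A mA.
  rewrite big_ord0 /= diracE (_ : _ \in _) //; apply/mem_set => -[].
  by [].
have mS : measurable [set x : 'rV[R]_n | forall i, A (lift ord0 i) (x ord0 i)].
  rewrite (_ : [set x | _] = \bigcap_(i in [set: 'I_n])
    ((fun x : 'rV[R]_n => x ord0 i) @^-1` A (lift ord0 i))); last first.
    by apply/seteqP; split=> x /= Ax i; [move=> _; exact: Ax|exact: Ax].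
  apply: fin_bigcap_measurable => // i _.
  by rewrite -[X in measurable X]setTI; exact: measurable_coord.
have := product_measure1E (@lebesgue_measure R) (lebesgue_row R n) (mA ord0) mS.
rewrite big_ord_recl -IHn // => <-.
rewrite /= /lebesgue_cons /pushforward.
congr (_ _); apply/seteqP; split=> [[a x] /= Ax|[a x] /= [Aa Ax] i].
  by split=> [|i]; [have := Ax ord0|have := Ax (lift ord0 i)];
    rewrite ?cons_row0 ?cons_rowS.
by case: (unliftP ord0 i) => [j ->|->]; rewrite ?cons_row0 ?cons_rowS.
Qed.

Section probability.
Context d (T : measurableType d) (R : realType) (P : probability T R).

Definition mutually_independent d' (T' : measurableType d') (I : eqType)
    (X : I -> T -> T') : Prop :=
  forall (J : seq I) (A : I -> set T'), uniq J ->
    (forall i, measurable (A i)) ->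
    P (\bigcap_(i in [set` J]) X i @^-1` A i) =
    (\prod_(i <- J) P (X i @^-1` A i))%E.

Definition weibull_distributed (gamma : R) (X : T -> R) : Prop :=
  forall x : R, 0 <= x -> P [set w | X w < x] = (1 - expR (- (x `^ gamma)))%:E.

Definition exponentially_distributed (rate : R) (X : T -> R) : Prop :=
  forall A : set R, measurable A -> P (X @^-1` A) = exponential_prob rate A.

Definition uniform_sign (S : T -> R) : Prop :=
  P [set w | S w = 1] = (2^-1)%:E /\ P [set w | S w = -1] = (2^-1)%:E.

Definition has_density n (X : T -> 'rV[R]_n) (p : 'rV[R]_n -> R) : Prop :=
  forall A : set 'rV[R]_n, measurable A ->
    P (X @^-1` A) = (\int[lebesgue_row R n]_(x in A) (p x)%:E)%E.

End probability.

Definition cvg_in_distribution d d' (T : measurableType d)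
    (T' : measurableType d') (R : realType) (P : probability T R)
    (Q : probability T' R) n (F : set_system R)
    (X : R -> T -> 'rV[R]_n) (Y : T' -> 'rV[R]_n) : Prop :=
  forall f : 'rV[R]_n -> R, continuous f -> (exists M, forall x, `|f x| <= M) ->
    ('E_P[f \o X t] @[t --> F] --> 'E_Q[f \o Y])%E.

Definition l1norm (K : numDomainType) n (x : 'rV[K]_n) : K :=
  \sum_(i < n) `|x ord0 i|.

Definition is_maximiser (S : Type) (R : realType) (f : S -> R) (z : S) : Prop :=
  forall y, f y <= f z.

Definition Psi (R : realType) n (gamma : R) (xi : 'rV[int]_n -> R) (t : R)
    (z : 'rV[int]_n) : R :=
  xi z - (l1norm z)%:~R / (gamma * t) * ln (ln t).

Definition spatial_scale (R : realType) (gamma t : R) : R :=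
  t * (ln t) `^ (gamma^-1 - 1) / ln (ln t).

Definition limit_rate (R : realType) n (gamma : R) : R :=
  n%:R `^ (1 - gamma^-1).

Definition limit_density (R : realType) n (gamma : R) (x : 'rV[R]_n) : R :=
  n%:R `^ (n%:R * (1 - gamma^-1)) / 2 ^+ n *
  expR (- (limit_rate n gamma * l1norm x)).

(* Main.v *)
(* Write c = slope t and r = spatial_scale t.  Since the limit density
   p has total mass 1, a pointwise lower bound suffices: if
   liminf r^d P(Z_t = floor (r x)) >= p(x) for every x, then dominated
   convergence applied to the minimum of both sides gives
   liminf E f(Z_t / r) >= int f p for every bounded continuous f >= 0, and the
   choices M + f and M - f turn this into convergence.

   For the pointwise bound, let u_v be the height with r^d exp(- u_v^gamma) = v.
   Then r^d P(xi >= u_v + c |z|) -> v exp(- kappa |x|) when z / r -> x, with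
   kappa = d^(1 - 1/gamma), and the expected number of sites with
   Psi >= u_v tends to lambda v, where lambda = int exp(- kappa |x|) dx.  The
   site z is the maximiser as soon as, for some j, Psi(z) lies in
   [u_(v_(j+1)), u_(v_j)) and Psi < u_(v_(j+1)) at all the other sites.  For
   v_j = j eta these events are disjoint and, by independence, have total
   probability asymptotic to at least
   r^-d exp(- kappa |x|) sum_j eta exp(- lambda (j + 1) eta), a Riemann sum for
   r^-d exp(- kappa |x|) / lambda = r^-d p(x).  The existence of a maximiser
   is thus never needed separately: with probability tending to 1 it is
   exhibited by these events. *)

Require Import Defs.
From HB Require Import structures.
From mathcomp Require Import all_boot all_order all_algebra.
From mathcomp Require Import all_classical all_reals all_analysis.
From mathcomp Require Import measurable_realfun ring lra.

Set Implicit Arguments.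
Unset Strict Implicit.
Unset Printing Implicit Defensive.

Import Order.TTheory GRing.Theory Num.Theory.
Import numFieldNormedType.Exports.

Local Open Scope classical_set_scope.
Local Open Scope ring_scope.

(** * Integrals over countable fibers and over row vectors *)

Section countable_fibers.
Context d (T : measurableType d) (K : countType) (phi : T -> K).
Hypothesis mphi : forall k, measurable (phi @^-1` [set k]).

Lemma measurable_countable_preimage (A : set K) : measurable (phi @^-1` A).
Proof.
rewrite (_ : _ @^-1` _ = \bigcup_(k in [set: K])
    (if k \in A then phi @^-1` [set k] else set0)); last first.
  apply/seteqP; split=> [x /= Ax|x [k _]].
    by exists (phi x) => //; rewrite mem_set.
  by case: ifPn => //; rewrite inE => Ak /= ->.
apply: countable_bigcupT_measurable; first exact: countableP.
by move=> k; case: ifPn.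
Qed.

Lemma measurable_countable_comp d' (T' : measurableType d') (g : K -> T') :
  measurable_fun setT (g \o phi).
Proof.
by move=> _ Y _; rewrite setTI comp_preimage; exact: measurable_countable_preimage.
Qed.

Variables (R : realType) (mu : {measure set T -> \bar R}).

(** Fibers are indexed by their [pickle] codes, so that countable additivity over the natural
    numbers applies. *)
Lemma integral_fibers (h : T -> \bar R) : measurable_fun setT h ->
  (forall x, 0 <= h x)%E ->
  (\int[mu]_x h x = \sum_(n <oo) \int[mu]_(x in [set x | pickle (phi x) = n]) h x)%E.
Proof.
move=> mh h0; rewrite -ge0_integral_bigcup//=.
- congr integral; apply/seteqP; split => // x _.
  by exists (pickle (phi x)).
- by move=> n; exact: (measurable_countable_preimage [set k | pickle k = n]).
- exact: measurable_funTS.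
- by apply/trivIsetP => i j _ _ ij; apply/seteqP; split => // x [/= ->] /eqP; rewrite (negbTE ij).
Qed.

End countable_fibers.

(** On each fiber [g] is constant, so comparing the masses fiber by fiber is enough. It is applied
    with [phi1] the cell map on R^d and [phi2] the maximiser, to pass from bounds on point
    probabilities to bounds on expectations. *)
Lemma ge0_le_integral_fibers d1 d2 (T1 : measurableType d1)
    (T2 : measurableType d2) (R : realType) (K : countType)
    (mu1 : {measure set T1 -> \bar R}) (mu2 : {measure set T2 -> \bar R})
    (phi1 : T1 -> K) (phi2 : T2 -> K) (g : K -> R) (rho : T1 -> R) :
  (forall k, measurable (phi1 @^-1` [set k])) ->
  (forall k, measurable (phi2 @^-1` [set k])) ->
  (forall k, 0 <= g k) -> measurable_fun setT rho -> (forall x, 0 <= rho x) ->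
  (forall k, \int[mu1]_(x in phi1 @^-1` [set k]) (rho x)%:E <=
             mu2 (phi2 @^-1` [set k]))%E ->
  (\int[mu1]_x (g (phi1 x) * rho x)%:E <= \int[mu2]_x (g (phi2 x))%:E)%E.
Proof.
move=> m1 m2 g0 mrho rho0 h12.
rewrite (integral_fibers m1); last 2 first.
  apply/measurable_EFinP; apply: measurable_funM => //.
  exact: (measurable_countable_comp m1 (g : K -> measurableTypeR R)).
  by move=> x; rewrite lee_fin mulr_ge0.
rewrite (integral_fibers m2); last 2 first.
  apply/measurable_EFinP.
  exact: (measurable_countable_comp m2 (g : K -> measurableTypeR R)).
  by move=> x; rewrite lee_fin.
apply: lee_nneseries => n _.
  by move=> _; apply: integral_ge0 => x _; rewrite lee_fin mulr_ge0.
(* A number that is the code of no element has an empty fiber and contributes 0. *)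
case: (pselect (exists k : K, pickle k = n)) => [[k kn]|nk]; last first.
  rewrite (_ : [set x | _] = set0) ?integral_set0; last first.
    by apply/seteqP; split => // x /= xn; apply: nk; exists (phi1 x).
  by apply: integral_ge0 => x _; rewrite lee_fin.
have E d (T : measurableType d) (f : T -> K) :
    [set x | pickle (f x) = n] = f @^-1` [set k].
  apply/seteqP; split => x /=; last by move=> ->.
  by rewrite -kn => /(pcan_inj pickleK).
rewrite !E.
rewrite (_ : (\int[mu2]_(x in _) _)%E = ((g k)%:E * mu2 (phi2 @^-1` [set k]))%E); last first.
  by rewrite -integral_cst//; apply: eq_integral => x; rewrite inE/= => ->.
rewrite (_ : (\int[mu1]_(x in _) _)%E =
    ((g k)%:E * \int[mu1]_(x in phi1 @^-1` [set k]) (rho x)%:E)%E); last first.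
  rewrite -ge0_integralZl_EFin//.
  - by apply: eq_integral => x; rewrite inE/= => ->; rewrite EFinM.
  - by move=> x _; rewrite lee_fin.
  - by apply/measurable_funTS/measurable_EFinP.
by rewrite lee_wpmul2l ?lee_fin.
Qed.

Section lebesgue_row_integral.
Context (R : realType).

Lemma integral_lebesgue_rowS n (F : 'rV[R]_n.+1 -> \bar R) :
  measurable_fun setT F -> (forall x, 0 <= F x)%E ->
  (\int[lebesgue_row R n.+1]_x F x =
   \int[lebesgue_measure]_a \int[lebesgue_row R n]_x F (cons_row (a, x)))%E.
Proof.
move=> mF F0.
transitivity (\int[lebesgue_measure \x lebesgue_row R n]_p F (cons_row p))%E.
  exact: (@ge0_integral_pushforward _ _ (measurableTypeR R * 'rV[R]_n)%type _ _ _
    (@measurable_cons_row R n) (lebesgue_measure \x lebesgue_row R n)%E _ _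
    measurableT mF (fun x _ => F0 x)).
rewrite fubini_tonelli1//.
by apply: (measurableT_comp mF); exact: measurable_cons_row.
Qed.

Lemma measurable_row_prod n (f : 'I_n -> R -> R) :
  (forall i, measurable_fun setT (f i)) ->
  measurable_fun setT (fun x : 'rV[R]_n => \prod_(i < n) f i (x ord0 i)).
Proof.
move=> mf; apply: measurable_prod => i _.
by apply: (measurableT_comp (mf i)); exact: measurable_coord.
Qed.

Lemma integral_row_prod n (f : 'I_n -> R -> R) :
  (forall i, measurable_fun setT (f i)) -> (forall i a, 0 <= f i a) ->
  (\int[lebesgue_row R n]_x (\prod_(i < n) f i (x ord0 i))%:E =
   \prod_(i < n) \int[lebesgue_measure]_a (f i a)%:E)%E.
Proof.
elim: n f => [|n IHn] f mf f0.
  rewrite big_ord0 /= integral_dirac//.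
    by rewrite diracT mul1e big_ord0.
  by apply/measurable_EFinP; apply: measurable_row_prod.
rewrite integral_lebesgue_rowS; last 2 first.
  by apply/measurable_EFinP; exact: measurable_row_prod.
  by move=> x; rewrite lee_fin prodr_ge0.
rewrite big_ord_recl -(IHn (fun i => f (lift ord0 i)))//.
have If_ge0 : (0 <= \int[lebesgue_row R n]_x
    (\prod_(i < n) f (lift ord0 i) (x ord0 i))%:E)%E.
  by apply: integral_ge0 => x _; rewrite lee_fin prodr_ge0.
rewrite muleC -ge0_integralZl//; last 2 first.
  by apply/measurable_EFinP; exact: mf.
  by move=> a _; rewrite lee_fin.
apply: eq_integral => a _; rewrite muleC -ge0_integralZl_EFin//; last 2 first.
  by move=> x _; rewrite lee_fin prodr_ge0.
  apply/measurable_EFinP.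
  apply: (@measurable_row_prod n (fun i => f (lift ord0 i))) => i; exact: mf.
apply: eq_integral => x _; rewrite big_ord_recl cons_row0 -EFinM; congr (_ * _)%:E.
by apply: eq_bigr => i _; rewrite cons_rowS.
Qed.

End lebesgue_row_integral.

(** * Discretisation of R^n into cubes of side 1/r *)

Section cells.
Context (R : realType) (n : nat).
Implicit Types (r : R) (x : 'rV[R]_n) (z : 'rV[int]_n).

(** The preimage of a site is a half-open cube of volume r^(-n), so a sum over sites is r^n times an
    integral over R^n. *)
Definition cell r x : 'rV[int]_n := \row_i Num.floor (x ord0 i * r).

Lemma cell_preimage r z : 0 < r -> cell r @^-1` [set z] =
  [set x | forall i, `[(z ord0 i)%:~R / r, (z ord0 i + 1)%:~R / r[%classic (x ord0 i)].
Proof.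
move=> r0; apply/seteqP; split => x /=.
  move=> <- i; rewrite in_itv/= mxE ler_pdivrMr// ltr_pdivlMr//.
  by rewrite floor_le floorD1_gt.
move=> xz; apply/rowP => i; rewrite mxE; apply/eqP; rewrite floor_eq.
by have := xz i; rewrite in_itv/= ler_pdivrMr// ltr_pdivlMr.
Qed.

Lemma measurable_row_box (A : 'I_n -> set R) : (forall i, measurable (A i)) ->
  measurable [set x : 'rV[R]_n | forall i, A i (x ord0 i)].
Proof.
move=> mA; rewrite (_ : [set x | _] = \bigcap_(i in [set: 'I_n])
    ((fun x : 'rV[R]_n => x ord0 i) @^-1` A i)); last first.
  by apply/seteqP; split=> x /= Ax i; [move=> _; exact: Ax|exact: Ax].
apply: fin_bigcap_measurable => // i _.
by rewrite -[X in measurable X]setTI; exact: measurable_coord.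
Qed.

Lemma measurable_cell r z : 0 < r -> measurable (cell r @^-1` [set z]).
Proof.
move=> r0; rewrite cell_preimage//.
by apply: (@measurable_row_box (fun i =>
  `[(z ord0 i)%:~R / r, (z ord0 i + 1)%:~R / r[%classic)) => i; exact: measurable_itv.
Qed.

Lemma lebesgue_row_cell r z : 0 < r ->
  lebesgue_row R n (cell r @^-1` [set z]) = (r ^- n)%:E.
Proof.
move=> r0; rewrite cell_preimage//.
rewrite (lebesgue_row_box (A := fun i =>
  `[(z ord0 i)%:~R / r, (z ord0 i + 1)%:~R / r[%classic))//.
rewrite (eq_bigr (fun=> (r^-1)%:E)) => [|i _].
  by rewrite prodEFin prodr_const card_ord exprVn.
rewrite /= lebesgue_measure_itv/= lte_fin ltr_pM2r ?invr_gt0// ltr_int ltrDl ltr01.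
by rewrite -EFinB -mulrBl -intrB addrC addKr mul1r.
Qed.

Lemma dist_cell r x i : 0 < r -> `|(cell r x ord0 i)%:~R / r - x ord0 i| <= r^-1.
Proof.
move=> r0; rewrite mxE -(ler_pM2r r0) mulVf ?gt_eqF//.
rewrite -[X in _ * X <= _](gtr0_norm r0) -normrM mulrBl -mulrA mulVf ?gt_eqF// mulr1 distrC.
have := floor_le (x ord0 i * r); have := floorD1_gt (x ord0 i * r).
by rewrite intrD1 ler_norml => /ltW ? ?; apply/andP; split; lra.
Qed.

Lemma cvg_cell (r : R^nat) x : r @ \oo --> +oo ->
  (r k)^-1 *: map_mx intr (cell (r k) x) @[k --> \oo] --> x.
Proof.
move=> roo; apply/cvg_ballP => e e0.
near=> k; split=> // i j; rewrite !ord1 !mxE.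
have rk0 : 0 < r k by near: k; exact: cvgry_gt.
rewrite /ball/= distrC; have := dist_cell x j rk0; rewrite mxE mulrC => /le_lt_trans; apply.
rewrite invf_plt ?posrE//; near: k; exact: cvgry_gt.
Unshelve. all: by end_near. Qed.

(** The sigma-algebra is generated by the coordinates, so [f] is written as the pointwise limit of
    its values at the corners of cubes of side 1/(k+1); these approximations factor through a
    countable type. *)
Lemma continuous_measurable_row (f : 'rV[R]_n -> R) : continuous f ->
  measurable_fun setT f.
Proof.
move=> cf; pose r k : R := k.+1%:R.
apply: (@measurable_fun_cvg _ _ _ _
  (fun k x => f ((r k)^-1 *: map_mx intr (cell (r k) x)))).
  move=> k; apply: (measurable_countable_comp _
    (fun z : 'rV[int]_n => f ((r k)^-1 *: map_mx intr z) : measurableTypeR R)).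
  by move=> z; exact: measurable_cell.
move=> x _; apply: (continuous_cvg _ (cf x)); apply: cvg_cell.
apply/cvgryPge => A; near=> k; apply: (@le_trans _ _ k%:R).
  by near: k; exact: nbhs_infty_ger.
by rewrite ler_nat.
Unshelve. all: by end_near. Qed.

End cells.

(** * The limit law *)

Section density.
Context d (T : measurableType d) (R : realType).
Variables (mu : {measure set T -> \bar R}) (p : T -> R).
Hypotheses (mp : measurable_fun setT p) (p0 : forall x, 0 <= p x).

Lemma density_probability : (\int[mu]_x (p x)%:E = 1)%E ->
  exists Q : probability T R, forall A, measurable A ->
    Q A = (\int[mu]_(x in A) (p x)%:E)%E.
Proof.
move=> p1; pose m A := (\int[mu]_(x in A) (p x)%:E)%E.
have m0 : m set0 = 0%E by rewrite /m integral_set0.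
have m_ge0 A : (0 <= m A)%E by apply: integral_ge0 => x _; rewrite lee_fin.
have m_sigma : semi_sigma_additive m.
  move=> F mF tF mUF; rewrite /m ge0_integral_bigcup//.
  - apply: is_cvg_nneseries => n _ _; exact: m_ge0.
  - exact/measurable_funTS/measurable_EFinP.
  - by move=> x _; rewrite lee_fin.
pose H1 := isMeasure.Build _ _ _ m m0 m_ge0 m_sigma.
pose M := HB.pack_for {measure set T -> \bar R} m H1.
pose H2 := @Measure_isProbability.Build _ _ R M p1.
by exists (HB.pack_for (probability T R) (Measure.sort M) H2).
Qed.

Import HBNNSimple.

(** On indicators this is the hypothesis on [Q]; linearity gives it for simple functions, and
    monotone convergence along [nnsfun_approx] for nonnegative measurable ones. *)
Lemma ge0_integral_density (Q : {measure set T -> \bar R}) (f : T -> R) :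
  (forall A, measurable A -> Q A = (\int[mu]_(x in A) (p x)%:E)%E) ->
  measurable_fun setT f -> (forall x, 0 <= f x) ->
  (\int[Q]_x (f x)%:E = \int[mu]_x (f x * p x)%:E)%E.
Proof.
move=> QE mf f0.
have mf' : measurable_fun setT (EFin \o f) by exact/measurable_EFinP.
pose h := nnsfun_approx measurableT mf'.
have hf x : (h n x)%:E @[n --> \oo] --> (f x)%:E.
  by apply: (cvg_nnsfun_approx measurableT mf') => // y _; rewrite lee_fin.
have hnd x : {homo (fun n => h n x) : m n / (m <= n)%N >-> m <= n}.
  by move=> m n mn; exact/lefP/nd_nnsfun_approx.
have hp x n m : (n <= m)%N -> ((h n x * p x)%:E <= (h m x * p x)%:E)%E.
  by move=> nm; rewrite lee_fin ler_wpM2r// hnd.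
have -> : (\int[Q]_x (f x)%:E = limn (fun n => \int[Q]_x (h n x)%:E))%E.
  rewrite -monotone_convergence//.
  - by apply: eq_integral => x _; apply/esym/cvg_lim => //; exact: hf.
  - by move=> n; apply/measurable_EFinP.
  - by move=> n x _; rewrite lee_fin.
  - by move=> x _ m n mn; rewrite lee_fin hnd.
have -> : (\int[mu]_x (f x * p x)%:E = limn (fun n => \int[mu]_x (h n x * p x)%:E))%E.
  rewrite -monotone_convergence//.
  - apply: eq_integral => x _; apply/esym/cvg_lim => //.
    under eq_fun do rewrite EFinM.
    by rewrite EFinM; apply: cvgeZr => //; exact: hf.
  - by move=> n; apply/measurable_EFinP; exact: measurable_funM.
  - by move=> n x _; rewrite lee_fin mulr_ge0.
  - by move=> x _ m n mn; exact: hp.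
congr (limn _); apply/funext => n.
have mI y : measurable (h n @^-1` [set y]) by exact: measurable_funPTI.
have hy y : y \in range (h n) -> 0 <= y by rewrite inE => -[x _ <-].
transitivity (\int[Q]_x \sum_(y \in range (h n)) (y * \1_(h n @^-1` [set y]) x)%:E)%E.
  by apply: eq_integral => x _; rewrite [in LHS](fimfunE (h n) x) -fsumEFin.
rewrite ge0_integral_fsum//; last 2 first.
  by move=> y; apply/measurable_EFinP; exact: measurable_funM.
  by move=> y x _; exact: nnfun_muleindic_ge0.
transitivity (\int[mu]_x \sum_(y \in range (h n))
    (y * \1_(h n @^-1` [set y]) x * p x)%:E)%E; last first.
  apply: eq_integral => x _; rewrite [in RHS](fimfunE (h n) x) fsumEFin//.
  by rewrite mulr_fsuml.
rewrite ge0_integral_fsum//; last 2 first.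
  by move=> y; apply/measurable_EFinP; do 2 (apply: measurable_funM => //).
  move=> y x _; rewrite lee_fin mulr_ge0// -lee_fin; exact: nnfun_muleindic_ge0.
apply: eq_fsbigr => y yh.
rewrite integralZl_indic_nnsfun// integral_indic// setIT QE//.
rewrite -ge0_integralZl_EFin//; last 3 first.
- by move=> x _; rewrite lee_fin.
- exact/measurable_funTS/measurable_EFinP.
- exact: hy.
rewrite integral_mkcond; apply: eq_integral => x _.
by rewrite patchE indicE; case: ifPn => _ /=; rewrite ?mulr1 ?mulr0n ?mulr0 ?mul0r ?EFinM.
Qed.

End density.

(** * One coordinate of the limit: the Laplace law *)

Section laplace.
Context (R : realType).
Notation mu := (@lebesgue_measure R).

(** Reflection preserves the length of intervals, and Lebesgue measure is determined by its values
    on them. *)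
Lemma lebesgue_measure_opp (A : set R) : measurable A ->
  mu (-%R @^-1` A) = mu A.
Proof.
move=> mA; have mopp : measurable_fun setT (-%R : measurableTypeR R -> measurableTypeR R).
  exact: oppr_measurable.
pose N := [the measure _ _ of pushforward mu (-%R : measurableTypeR R -> measurableTypeR R)].
apply/esym; apply: (@lebesgue_measure_unique R (N mopp) _ A mA) => X [[a b] _ <-] /=.
rewrite /pushforward (_ : _ @^-1` _ = `[- b, - a[%classic); last first.
  by apply/seteqP; split => x /=; rewrite !in_itv/= => /andP[? ?]; apply/andP; split; lra.
rewrite !lebesgue_measure_itv/= !lte_fin ltrN2; case: ifP => // _.
by rewrite -!EFinB opprK addrC.
Qed.

Lemma ge0_integral_opp (f : R -> R) (A : set R) : measurable A ->
  measurable_fun setT f -> (forall x, 0 <= f x) ->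
  (\int[mu]_(x in -%R @^-1` A) (f (- x))%:E = \int[mu]_(x in A) (f x)%:E)%E.
Proof.
move=> mA mf f0.
have mopp : measurable_fun setT (-%R : measurableTypeR R -> measurableTypeR R).
  exact: oppr_measurable.
have := @ge0_integral_pushforward _ _ _ _ _ _ mopp mu A (EFin \o f) mA
  (measurable_funTS (iffRL (measurable_EFinP _ _) mf)) (fun x _ => f0 x).
move=> /= <-; apply: eq_measure_integral => B mB _.
by rewrite /= /pushforward lebesgue_measure_opp.
Qed.

Variable k : R.
Hypothesis k0 : 0 < k.

(** The density of a uniform random sign times an independent exponential variable of rate [k]. *)
Definition laplace_pdf (x : R) := k / 2 * expR (- (k * `|x|)).

Lemma laplace_pdf_ge0 x : 0 <= laplace_pdf x.
Proof. by rewrite mulr_ge0 ?expR_ge0// divr_ge0// ltW. Qed.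

Lemma measurable_laplace_pdf : measurable_fun setT laplace_pdf.
Proof.
apply: measurable_funM => //; apply: measurableT_comp => //.
apply: measurableT_comp => //; apply: measurable_funM => //.

Qed.

Lemma integral_laplace_pos (A : set R) : measurable A ->
  (\int[mu]_(x in [set x : R | (0 < x)%R /\ A `|x|%R]) (laplace_pdf x)%:E =
   (2^-1)%:E * exponential_prob k A)%E.
Proof.
move=> mA.
have mP : measurable [set x : R | 0 < x].
  by rewrite -set_itvoy; exact: measurable_itv.
have mexp := @measurable_exponential_pdf R k.
rewrite /exponential_prob -ge0_integralZl_EFin//; last 2 first.
  by move=> x _; rewrite lee_fin exponential_pdf_ge0// ltW.
  exact/measurable_funTS/measurable_EFinP.
rewrite (_ : [set x | _] = A `&` [set x | 0 < x]); last first.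
  apply/seteqP; split => x /= [].
    by move=> x0; rewrite gtr0_norm.
  by move=> + x0; rewrite gtr0_norm.
rewrite integral_mkcondr; apply: ge0_ae_eq_integral => //.
- rewrite -measurable_restrict//; apply/measurable_funTS/measurable_EFinP.
  exact: measurable_laplace_pdf.
- apply/measurable_funTS/measurable_EFinP; exact: measurable_funM.
- by move=> x _; rewrite erestrict_ge0// => y _; rewrite lee_fin laplace_pdf_ge0.
- by move=> x _; rewrite lee_fin mulr_ge0// exponential_pdf_ge0// ltW.
(* The two integrands agree for x > 0 and both vanish for x < 0; they can differ only at 0. *)
exists [set 0]; split => //; first exact: lebesgue_measure_set1.
move=> x /= /not_implyP[Ax]; apply: contra_notP => /eqP x0.
rewrite patchE; case: ifPn => [|xN].
  rewrite inE/= => xp; rewrite exponential_pdfE ?ltW// /laplace_pdf gtr0_norm//.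
  by rewrite -EFinM mulNr mulrA (mulrC 2^-1).
rewrite lt0_exponential_pdf ?mule0// lt_neqAle x0/= leNgt.
by apply: contra xN => xp; rewrite inE.
Qed.

Lemma integral_laplace_neg (A : set R) : measurable A ->
  (\int[mu]_(x in [set x : R | (x < 0)%R /\ A `|x|%R]) (laplace_pdf x)%:E =
   (2^-1)%:E * exponential_prob k A)%E.
Proof.
move=> mA; rewrite -integral_laplace_pos// -[RHS]ge0_integral_opp.
- rewrite (_ : -%R @^-1` _ = [set x : R | (x < 0)%R /\ A `|x|%R]).
    by apply: eq_integral => x _; rewrite /laplace_pdf normrN.
  by apply/seteqP; split => x /=; rewrite normrN oppr_gt0.
- have mP : measurable [set x : R | 0 < x].
    by rewrite -set_itvoy; exact: measurable_itv.
  apply: measurableI => //; rewrite -[X in measurable X]setTI.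
  by apply: normr_measurable.
- exact: measurable_laplace_pdf.
- exact: laplace_pdf_ge0.
Qed.

(** The joint law of sign and modulus factorises: half the number of elements of {1, -1} lying in
    [B], times an exponential probability. The laws of the sign and of the modulus, and their
    independence, are all read off from this formula. *)
Lemma integral_laplace_polar (B A : set R) : measurable A ->
  (\int[mu]_(x in [set x : R | B (Num.sg x) /\ A `|x|%R]) (laplace_pdf x)%:E =
   ((\1_B 1 + \1_B (-1)) / 2)%:E * exponential_prob k A)%E.
Proof.
move=> mA; pose S (s : R) : set R := [set a | B s /\ A a].
have mS s : measurable (S s).
  have [Bs|nBs] := pselect (B s).
    by rewrite (_ : S s = A)//; apply/seteqP; split => // x [].
  by rewrite (_ : S s = set0)//; apply/seteqP; split => // x [].
have mabs (C : set R) : measurable C -> measurable [set x : R | C `|x|%R].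
  by move=> mC; rewrite -[X in measurable X]setTI; apply: normr_measurable.
have mP : measurable [set x : R | 0 < x].
  by rewrite -set_itvoy; exact: measurable_itv.
have mN : measurable [set x : R | x < 0].
  by rewrite -set_itvNyo; exact: measurable_itv.
have mpos : measurable [set x : R | (0 < x)%R /\ S 1 `|x|%R].
  by apply: measurableI => //; exact: mabs.
have mneg : measurable [set x : R | (x < 0)%R /\ S (-1) `|x|%R].
  by apply: measurableI => //; exact: mabs.
have mU := measurableU _ _ mpos mneg.
have mZ : measurable [set x : R | x = 0 /\ S 0 `|x|%R].
  by apply: measurableI; [exact: measurable_set1|exact: mabs].
have mL D : measurable_fun D (EFin \o laplace_pdf).
  by apply/measurable_funTS/measurable_EFinP; exact: measurable_laplace_pdf.
have L0 x : (0 <= (laplace_pdf x)%:E)%E by rewrite lee_fin laplace_pdf_ge0.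
rewrite (_ : [set x | _] = ([set x : R | (0 < x)%R /\ S 1 `|x|%R] `|`
    [set x : R | (x < 0)%R /\ S (-1) `|x|%R]) `|`
    [set x : R | x = 0 /\ S 0 `|x|%R]); last first.
  apply/seteqP; split => x /=.
    case=> Bx Ax; have [|xn|xz] := ltgtP 0 x.
    - by move=> x0; left; left; rewrite -(gtr0_sg x0).
    - by left; right; rewrite -(ltr0_sg xn).
    - by right; move: Bx Ax; rewrite -xz sgr0.
  case=> [[]|] [x0 []].
  - by rewrite gtr0_sg.
  - by rewrite ltr0_sg.
  - by rewrite x0 sgr0.
rewrite ge0_integral_setU//=; last 2 first.
- exact: mL.
- by apply/disj_setPLR => x /= [[x0 _]|[x0 _]] [x00]; rewrite x00 ltxx in x0.
(* The part with sign 0 lies in {0}, a null set. *)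
rewrite [X in (_ + X)%E](@integral_Sset1 _ _ _ 0) ?adde0; last by move=> x [].
rewrite ge0_integral_setU//=; last 2 first.
- exact: mL.
- by apply/disj_setPLR => x /= [x0 _] [/(lt_trans x0)]; rewrite ltxx.
rewrite integral_laplace_pos// integral_laplace_neg// mulrDl.
have SE s : exponential_prob k (S s) = ((\1_B s)%:E * exponential_prob k A)%E.
  rewrite indicE; have [Bs|nBs] := pselect (B s).
    rewrite mem_set// mul1e; congr exponential_prob.
    by apply/seteqP; split => // x [].
  rewrite memNset// mul0e (_ : S s = set0).
    by rewrite /exponential_prob integral_set0.
  by apply/seteqP; split => // x [].
have E0 : (0 <= exponential_prob k A)%E.
  by apply: integral_ge0 => x _; rewrite lee_fin exponential_pdf_ge0// ltW.
rewrite !SE !muleA -ge0_muleDl ?mule_ge0 ?lee_fin//.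
by rewrite -!EFinM -EFinD !(mulrC 2^-1).
Qed.

Lemma integral_laplace_norm (A : set R) : measurable A ->
  (\int[mu]_(x in [set x : R | A `|x|%R]) (laplace_pdf x)%:E = exponential_prob k A)%E.
Proof.
move=> /(integral_laplace_polar setT); rewrite !indicT /= (_ : (1 + 1) / 2 = 1) ?mul1e; last by lra.
move=> <-; by congr integral; apply/seteqP; split => // x [].
Qed.

Lemma exponential_probT : exponential_prob k setT = 1%E.
Proof. by rewrite /exponential_prob integral_exponential_pdf. Qed.

Lemma integral_laplaceT : (\int[mu]_x (laplace_pdf x)%:E = 1)%E.
Proof.
by have := integral_laplace_norm measurableT; rewrite exponential_probT.
Qed.

End laplace.

(** * The product Laplace law on R^n *)

Section laplace_row.
Context (R : realType) (n : nat) (k : R).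
Hypothesis k0 : 0 < k.

(** With [k = limit_rate n gamma] this is the limit density; the product form makes the independence
    of the coordinates a statement about boxes. *)
Definition laplace_row_pdf (x : 'rV[R]_n) := \prod_(i < n) laplace_pdf k (x ord0 i).

Lemma laplace_row_pdfE x :
  laplace_row_pdf x = (k / 2) ^+ n * expR (- (k * l1norm x)).
Proof.
rewrite /laplace_row_pdf big_split /= prodr_const card_ord; congr (_ * _).
rewrite -expR_sum; congr expR; rewrite /l1norm mulr_sumr.
by rewrite sumrN.
Qed.

Lemma laplace_row_pdf_gt0 x : 0 < laplace_row_pdf x.
Proof. by rewrite laplace_row_pdfE mulr_gt0 ?expR_gt0// exprn_gt0// divr_gt0. Qed.

Lemma measurable_laplace_row_pdf : measurable_fun setT laplace_row_pdf.
Proof.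
by apply: (@measurable_row_prod _ _ (fun=> laplace_pdf k)) => i; exact: measurable_laplace_pdf.
Qed.

Lemma integral_laplace_row : (\int[lebesgue_row R n]_x (laplace_row_pdf x)%:E = 1)%E.
Proof.
rewrite (@integral_row_prod _ _ (fun=> laplace_pdf k)).
- by rewrite big1// => i _; exact: integral_laplaceT.
- by move=> i; exact: measurable_laplace_pdf.
- by move=> i a; exact: laplace_pdf_ge0.
Qed.

Lemma integral_laplace_row_box (A : 'I_n -> set R) : (forall i, measurable (A i)) ->
  (\int[lebesgue_row R n]_(x in [set x | forall i, A i (x ord0 i)]) (laplace_row_pdf x)%:E =
   \prod_(i < n) \int[lebesgue_measure]_(a in A i) (laplace_pdf k a)%:E)%E.
Proof.
move=> mA; have mL i : measurable_fun setT (laplace_pdf k \_ (A i)).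
  by rewrite -measurable_restrictT//; apply: measurable_funTS; exact: measurable_laplace_pdf.
have L0 i a : 0 <= (laplace_pdf k \_ (A i)) a.
  by rewrite restrict_ge0// => ? _; exact: laplace_pdf_ge0.
rewrite [RHS](eq_bigr (fun i => \int[lebesgue_measure]_a ((laplace_pdf k \_ (A i)) a)%:E)%E).
  rewrite -(@integral_row_prod _ _ (fun i => laplace_pdf k \_ (A i)))//.
  rewrite integral_mkcond; apply: eq_integral => x _.
  rewrite patchE; case: ifPn => [|].
    rewrite inE/= => xA; congr (_%:E); apply: eq_bigr => i _.
    by rewrite patchE mem_set.
  move=> /negP; rewrite inE/= => /existsNP[i xi].
  by rewrite (bigD1 i)//= patchE memNset// mul0r.
move=> i _; rewrite integral_mkcond; apply: eq_integral => a _.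
by rewrite !patchE; case: ifPn.
Qed.

Variable Q : probability 'rV[R]_n R.
Hypothesis QE : forall A, measurable A ->
  Q A = (\int[lebesgue_row R n]_(x in A) (laplace_row_pdf x)%:E)%E.

Lemma laplace_row_marginal i (A : set R) : measurable A ->
  Q [set x | A (x ord0 i)] = (\int[lebesgue_measure]_(a in A) (laplace_pdf k a)%:E)%E.
Proof.
move=> mA; pose B j := if j == i then A else setT.
have mB j : measurable (B j) by rewrite /B; case: ifP.
rewrite (_ : [set x | _] = [set x | forall j, B j (x ord0 j)]).
  rewrite QE; last exact: measurable_row_box.
  rewrite integral_laplace_row_box// (bigD1 i)//= /B eqxx big1 ?mule1// => j /negbTE ->.
  exact: integral_laplaceT.
apply/seteqP; split => x /=; last by move=> /(_ i); rewrite /B eqxx.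
by move=> Ax j; rewrite /B; case: eqP => // ->.
Qed.

(** Coordinates outside [J] are constrained by the full line, which contributes a factor 1, so the
    event is a box and its integral is a product. *)
Lemma laplace_row_independent : mutually_independent Q (fun i (x : 'rV[R]_n) => x ord0 i).
Proof.
move=> J A uJ mA; pose B j := if j \in J then A j else setT.
have mB j : measurable (B j) by rewrite /B; case: ifP.
rewrite (_ : bigcap _ _ = [set x : 'rV[R]_n | forall j : 'I_n, B j (x ord0 j)]).
  rewrite QE; last exact: measurable_row_box.
  rewrite integral_laplace_row_box// [RHS]big_uniq//= (bigID (mem J))/=.
  rewrite [X in (_ * X)%E]big1 ?mule1.
    apply: eq_bigr => i iJ; rewrite /B iJ -(laplace_row_marginal i)//.
  by move=> i /negbTE iJ; rewrite /B iJ integral_laplaceT.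
apply/seteqP; split => x /=.
  by move=> Ax j; rewrite /B; case: ifPn => // jJ; exact: Ax.
by move=> Bx j /= jJ; have := Bx j; rewrite /B jJ.
Qed.

Lemma measurable_polar (B A : set R) : measurable A ->
  measurable [set x : R | B (Num.sg x) /\ A `|x|%R].
Proof.
move=> mA; apply: measurableI; last first.
  by rewrite -[X in measurable X]setTI; apply: normr_measurable.
rewrite (_ : (fun x : R => B (Num.sg x)) = (`]-oo, 0[%classic `&` [set _ | B (-1)]) `|`
  (`]0, +oo[%classic `&` [set _ | B 1]) `|` ([set 0] `&` [set _ | B 0])).
  have mc (P : Prop) : measurable [set _ : R | P].
    have [p|p] := pselect P.
      by rewrite (_ : [set _ | _] = setT)//; apply/seteqP; split.
    by rewrite (_ : [set _ | _] = set0)//; apply/seteqP; split.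
  by apply: measurableU; [apply: measurableU|]; exact: measurableI.
apply/seteqP; split => x /=.
  rewrite !in_itv/= ?andbT; have [x0|x0|<-] := ltgtP 0 x.
  - by rewrite gtr0_sg//; left; right.
  - by rewrite ltr0_sg//; left; left.
  - by rewrite sgr0; right.
rewrite !in_itv/= ?andbT => -[[]|] [x0].
- by rewrite ltr0_sg.
- by rewrite gtr0_sg.
- by rewrite x0 sgr0.
Qed.

Lemma laplace_row_polar i (B A : set R) : measurable A ->
  Q [set x | B (Num.sg (x ord0 i)) /\ A `|x ord0 i|%R] =
  (((\1_B 1 + \1_B (-1)) / 2)%:E * exponential_prob k A)%E.
Proof.
move=> mA; rewrite -integral_laplace_polar// -(laplace_row_marginal i)//.
exact: measurable_polar.
Qed.

Lemma laplace_row_norm i (A : set R) : measurable A ->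
  Q [set x | A `|x ord0 i|%R] = exponential_prob k A.
Proof.
move=> mA; have := laplace_row_polar i setT mA.
rewrite !indicT /= (_ : (1 + 1) / 2 = 1) ?mul1e; last by lra.
move=> <-; congr (Q _); by apply/seteqP; split => // x [].
Qed.

Lemma laplace_row_sg i (B : set R) :
  Q [set x | B (Num.sg (x ord0 i))] = ((\1_B 1 + \1_B (-1)) / 2)%:E.
Proof.
have := laplace_row_polar i B measurableT; rewrite exponential_probT// mule1 => <-.
by congr (Q _); apply/seteqP; split => // x [].
Qed.

Lemma laplace_row_uniform_sign i : uniform_sign Q (fun x => Num.sg (x ord0 i)).
Proof.
have N1 : (1 == -1 :> R) = false by apply/eqP => ?; lra.
split.
- rewrite (laplace_row_sg i [set 1]) !indicE; congr (_%:E).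
  by rewrite mem_set// memNset /= ?addr0 ?mul1r// => /eqP; rewrite eq_sym N1.
- rewrite (laplace_row_sg i [set -1]) !indicE; congr (_%:E).
  by rewrite memNset /= ?mem_set//= ?add0r ?mul1r// => /eqP; rewrite N1.
Qed.

Lemma laplace_row_sg_norm_independent i : mutually_independent Q
  (fun (b : bool) (x : 'rV[R]_n) => if b then Num.sg (x ord0 i) else `|x ord0 i|%R).
Proof.
have pol (B A : set R) : measurable A ->
   Q [set x : 'rV[R]_n | B (Num.sg (x ord0 i)) /\ A `|x ord0 i|%R] =
   (Q [set x : 'rV[R]_n | B (Num.sg (x ord0 i))] * Q [set x : 'rV[R]_n | A `|x ord0 i|%R])%E.
  by move=> mA; rewrite laplace_row_polar// laplace_row_sg laplace_row_norm.
case=> [|b [|c J]] A.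
- by move=> _ _; rewrite set_nil bigcap_set0 probability_setT big_nil.
- by move=> _ _; rewrite set_cons1 bigcap_set1 big_seq1.
rewrite /= !inE => /andP[/norP[bc bJ] /andP[cJ _]] mA.
(* Two distinct booleans exhaust the index type, so a duplicate-free list has no further element. *)
have {bJ cJ} -> : J = [::].
  by case: J bJ cJ => // e J; rewrite !inE; case: b bc; case: c; case: e.
rewrite big_cons big_seq1 (_ : bigcap _ _ =
    [set x : 'rV[R]_n | A true (Num.sg (x ord0 i)) /\ A false `|x ord0 i|%R]).
  rewrite pol//; case: b c bc => -[] //= _; exact: muleC.
apply/seteqP; split => x /=.
  move=> Ax; split.
    by apply: (Ax true); rewrite /= !inE; case: b c bc {Ax} => -[].
  by apply: (Ax false); rewrite /= !inE; case: b c bc {Ax} => -[].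
by case=> A1 A2 [].
Qed.

End laplace_row.

(** * Asymptotics of the Weibull tail *)

Section ln_powR_bounds.
Context (R : realType).
Implicit Types a b p s y g : R.

Lemma ln_tangent a b : 0 < a -> 0 < b -> ln b <= ln a + (b - a) / a.
Proof.
move=> a0 b0; rewrite -lerBlDl -ln_div ?posrE//.
have -> : b / a = 1 + (b - a) / a by rewrite mulrBl divff ?gt_eqF// addrC subrK.
by apply: le_ln1Dx; rewrite mulrBl divff ?gt_eqF// ltrBrDr addrC subrr divr_gt0.
Qed.

Lemma ln1D_ge y : 0 <= y -> y / (1 + y) <= ln (1 + y).
Proof.
move=> y0; have y1 : 0 < 1 + y by lra.
have := ln_tangent y1 (@ltr01 R); rewrite ln1 => ?.
have -> : y / (1 + y) = - ((1 - (1 + y)) / (1 + y)) by field; rewrite gt_eqF.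
by lra.
Qed.

(* The logarithm of Bernoulli's inequality [1 + p y <= (1 + y) `^ p]. *)
Lemma ln1DM_le p y : 1 <= p -> 0 <= y -> ln (1 + p * y) <= p * ln (1 + y).
Proof.
move=> p1 y0; have y1 : 0 < 1 + y by lra.
have py1 : 0 < 1 + p * y by rewrite ltr_pwDl// mulr_ge0//; lra.
have := ln_tangent y1 py1.
have -> : (1 + p * y - (1 + y)) / (1 + y) = (p - 1) * (y / (1 + y)).
  by field; rewrite gt_eqF.
move/le_trans; apply; rewrite -lerBrDl -{2}(mul1r (ln _)) -mulrBl.
by rewrite ler_wpM2l ?subr_ge0// ln1D_ge.
Qed.

Lemma powR1D_ge g y : 0 <= y -> 1 + g * ln (1 + y) <= (1 + y) `^ g.
Proof.
by move=> y0; rewrite /powR gt_eqF; [exact: expR_ge1Dx|lra].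
Qed.

(** With a = g ln(1 + y) <= g y, this follows from exp(a) (1 - a) <= 1. Together with the lower
    bound [powR1D_ge] it controls (1 + y)^g - 1 by g y up to a factor tending to 1 as y -> 0, for
    convex and concave powers alike. *)
Lemma powR1D_le g y : 0 < g -> 0 <= y -> (1 + y) `^ g <= 1 + g * y * (1 + y) `^ g.
Proof.
move=> g0 y0; have y1 : 0 < 1 + y by lra.
rewrite /powR gt_eqF//; set a := g * ln (1 + y).
have agy : a <= g * y by rewrite /a ler_wpM2l ?(ltW g0)// le_ln1Dx//; lra.
have := expR_ge1Dx (- a) => ha.
have e0 := expR_gt0 a.
have : expR a * (1 - a) <= expR a * expR (- a) by rewrite ler_wpM2l ?(ltW e0).
rewrite -expRD subrr expR0 => h1.
have : expR a * a <= expR a * (g * y) by rewrite ler_wpM2l// ltW.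
by rewrite (mulrC (g * y)); lra.
Qed.

Lemma cvg_powR_base (f : R^nat) (l g : R) : 0 < l -> f @ \oo --> l ->
  f k `^ g @[k --> \oo] --> l `^ g.
Proof.
move=> l0 fl; rewrite [X in _ --> X]/powR gt_eqF//.
apply: (@cvg_trans _ (expR (g * ln (f k)) @[k --> \oo])).
  apply: near_eq_cvg; near=> k.
  have : 0 < f k by near: k; exact: (cvgr_gt l).
  by rewrite /powR => /gt_eqF ->.
apply: continuous_cvg; first exact: continuous_expR.
by apply: cvgMl_tmp; apply: continuous_cvg => //; exact: continuous_ln.
Unshelve. all: by end_near. Qed.

Lemma cvg_ln_pinfty (f : R^nat) : f @ \oo --> +oo -> ln (f k) @[k --> \oo] --> +oo.
Proof.
move=> foo; apply/cvgryPge => A; near=> k.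
have fk : expR A <= f k by near: k; exact: cvgry_ge.
by rewrite -ler_expR lnK// posrE (lt_le_trans (expR_gt0 A)).
Unshelve. all: by end_near. Qed.

Lemma cvg_inv_pinfty (f : R^nat) : f @ \oo --> +oo -> (f k)^-1 @[k --> \oo] --> (0 : R).
Proof. by move=> foo; apply/gtr0_cvgV0 => //; exact: cvgry_gt. Qed.

Lemma ln_le_sqrt y : 0 < y -> ln y <= 2 * Num.sqrt y.
Proof.
move=> y0; rewrite -{1}(sqr_sqrtr (ltW y0)) lnXn ?sqrtr_gt0// mulr_natl.
rewrite lerMn2r/= -{1}[Num.sqrt y](subrK 1) addrC.
have := @le_ln1Dx R (Num.sqrt y - 1); have : 0 < Num.sqrt y by rewrite sqrtr_gt0.
by move=> ? h; apply: le_trans (h _) _; lra.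
Qed.

Lemma cvg_ln_div (f : R^nat) : f @ \oo --> +oo -> ln (f k) / f k @[k --> \oo] --> 0.
Proof.
move=> foo; apply/cvgr0Pnorm_le => e e0; near=> k.
have fk1 : 1 <= f k by near: k; exact: cvgry_ge.
have fk : (2 / e) ^+ 2 <= f k by near: k; exact: cvgry_ge.
have fk0 : 0 < f k by rewrite (lt_le_trans _ fk1).
rewrite ger0_norm ?divr_ge0 ?ln_ge0 ?(ltW fk0)// ler_pdivrMr//.
apply: (le_trans (ln_le_sqrt fk0)); set q := Num.sqrt (f k).
have q0 : 0 < q by rewrite sqrtr_gt0.
have eq2 : 2 / e <= q.
  by rewrite -(ler_pXn2r (n := 2))// ?nnegrE ?(ltW q0) ?divr_ge0 ?(ltW e0)//
    sqr_sqrtr ?(ltW fk0).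
rewrite -[f k]sqr_sqrtr ?(ltW fk0)// -/q expr2 mulrA ler_wpM2r ?(ltW q0)//.
by rewrite mulrC -ler_pdivrMr.
Unshelve. all: by end_near. Qed.

End ln_powR_bounds.

(** * The spatial scale and the heights of the field *)

Section scaling.
Context (R : realType) (d : nat) (gamma : R).
Hypotheses (hd : (1 <= d)%N) (gamma0 : 0 < gamma).
Implicit Types v t : R.

(** The penalty in [Psi] per unit of l1-distance. *)
Definition slope (t : R) := ln (ln t) / (gamma * t).
(** The solution s of r^d exp(- s) = v; the height u_v, called [level], is s^(1/gamma). *)
Definition log_level (v t : R) := d%:R * ln (spatial_scale gamma t) - ln v.
Definition level (v t : R) := log_level v t `^ gamma^-1.
Definition weibull_tail (x : R) := expR (- (x `^ gamma)).

Notation r := (spatial_scale gamma).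
Notation kappa := (limit_rate d gamma).

Let d0 : 0 < d%:R :> R. Proof. by rewrite ltr0n. Qed.

Lemma limit_rate_gt0 : 0 < kappa. Proof. exact: powR_gt0. Qed.

Lemma lnln_gt0 (t : R) : expR 1 < t -> [/\ 0 < t, 1 < ln t & 0 < ln (ln t)].
Proof.
move=> et; have t0 : 0 < t by rewrite (lt_trans (expR_gt0 1)).
have lt1 : 1 < ln t by rewrite -ltr_expR lnK ?posrE.
by split => //; rewrite ln_gt0.
Qed.

Lemma spatial_scale_gt0 t : expR 1 < t -> 0 < r t.
Proof.
move=> /lnln_gt0[t0 lt1 llt0].
by rewrite divr_gt0// mulr_gt0// powR_gt0// (lt_trans ltr01).
Qed.

Lemma slope_gt0 t : expR 1 < t -> 0 < slope t.
Proof. by move=> /lnln_gt0[t0 lt1 llt0]; rewrite divr_gt0// mulr_gt0. Qed.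

Lemma slope_scale t : expR 1 < t -> slope t * r t = ln t `^ (gamma^-1 - 1) / gamma.
Proof.
move=> /lnln_gt0[t0 lt1 llt0]; rewrite /slope /spatial_scale; field.
by rewrite !gt_eqF.
Qed.

Lemma ln_spatial_scale t : expR 1 < t ->
  ln (r t) = ln t + (gamma^-1 - 1) * ln (ln t) - ln (ln (ln t)).
Proof.
move=> /lnln_gt0[t0 lt1 llt0]; have l0 := lt_trans ltr01 lt1.
rewrite ln_div ?posrE ?mulr_gt0 ?powR_gt0// lnM ?posrE ?powR_gt0//.
by rewrite ln_powR.
Qed.

Lemma weibull_tail_level v t : 0 < v -> expR 1 < t -> 0 <= log_level v t ->
  r t ^+ d * weibull_tail (level v t) = v.
Proof.
move=> v0 et s0; rewrite /weibull_tail -powRrM mulVf ?gt_eqF// powRr1//.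
rewrite opprB expRD expRN lnK ?posrE// expRM_natl lnK ?posrE ?spatial_scale_gt0//.
by rewrite mulrCA divff ?mulr1// expf_neq0 ?gt_eqF ?spatial_scale_gt0.
Qed.

Variable t : R^nat.
Hypothesis t_oo : t @ \oo --> +oo.

Lemma near_gte : \forall k \near \oo, expR 1 < t k.
Proof. exact: cvgry_gt. Qed.

Let L_oo : ln (t k) @[k --> \oo] --> +oo. Proof. exact: cvg_ln_pinfty. Qed.

(** The scale differs from t by factors whose logarithms are multiples of ln ln t and ln ln ln t,
    negligible against ln t. *)
Lemma cvg_ln_scale : ln (r (t k)) / ln (t k) @[k --> \oo] --> (1 : R).
Proof.
have LL : ln (ln (t k)) / ln (t k) @[k --> \oo] --> 0 by exact: cvg_ln_div.
have LLL : ln (ln (ln (t k))) / ln (t k) @[k --> \oo] --> 0.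
  have LL_oo := cvg_ln_pinfty L_oo.
  apply: (@squeeze_cvgr _ _ _ _ (fun=> 0) (fun k => ln (ln (t k)) / ln (t k))) => //.
    near=> k.
    have et : expR 1 < t k by near: k; exact: near_gte.
    have [t0 lt1 llt0] := lnln_gt0 et.
    have ll1 : 1 <= ln (ln (t k)) by near: k; exact: cvgry_ge.
    have l0 := lt_trans ltr01 lt1.
    apply/andP; split; first by apply: divr_ge0; [exact: ln_ge0|exact: ltW].
    rewrite ler_pM2r ?invr_gt0//.
    have := @le_ln1Dx R (ln (ln (t k)) - 1); rewrite (addrC 1) subrK => h.
    by apply: le_trans (h _) _; lra.
  exact: cvg_cst.
have : 1 + (gamma^-1 - 1) * (ln (ln (t k)) / ln (t k)) -
    ln (ln (ln (t k))) / ln (t k) @[k --> \oo] --> 1 + (gamma^-1 - 1) * 0 - 0.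
  by apply: cvgB => //; apply: cvgD; [exact: cvg_cst|exact: cvgMl_tmp].
rewrite mulr0 addr0 subr0; apply: cvg_trans; apply: near_eq_cvg; near=> k.
  have et : expR 1 < t k by near: k; exact: near_gte.
  have [t0 lt1 llt0] := lnln_gt0 et.
  have l0 := lt_trans ltr01 lt1.
  by rewrite ln_spatial_scale//; field; rewrite !gt_eqF.
Unshelve. all: by end_near. Qed.

Lemma cvg_log_level_ratio v : log_level v (t k) / ln (t k) @[k --> \oo] --> (d%:R : R).
Proof.
have : d%:R * (ln (r (t k)) / ln (t k)) - ln v * (ln (t k))^-1 @[k --> \oo] -->
    d%:R * (1 : R) - ln v * 0.
  apply: cvgB; apply: cvgMl_tmp; first exact: cvg_ln_scale.
  exact: cvg_inv_pinfty.
rewrite mulr0 subr0 mulr1; apply: cvg_trans; apply: near_eq_cvg; near=> k.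
by rewrite /log_level mulrBl mulrA.
Unshelve. all: by end_near. Qed.

Lemma cvg_mul_pinfty (f g : R^nat) (l : R) : 0 < l -> f @ \oo --> l ->
  g @ \oo --> +oo -> f k * g k @[k --> \oo] --> +oo.
Proof.
move=> l0 fl goo; apply/cvgryPge => A; near=> k.
have fk : l / 2 <= f k by near: k; apply: (cvgr_ge l) => //; lra.
have gk0 : 0 <= g k by near: k; exact: cvgry_ge.
apply: (@le_trans _ _ (l / 2 * g k)); last by rewrite ler_wpM2r.
by rewrite mulrC -ler_pdivrMr ?divr_gt0//; near: k; exact: cvgry_ge.
Unshelve. all: by end_near. Qed.

Lemma cvg_log_level v : log_level v (t k) @[k --> \oo] --> +oo.
Proof.
have := cvg_mul_pinfty d0 (@cvg_log_level_ratio v) L_oo.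
apply: cvg_trans; apply: near_eq_cvg; near=> k.
have et : expR 1 < t k by near: k; exact: near_gte.
have [t0 lt1 llt0] := lnln_gt0 et.
by rewrite divfK// gt_eqF// (lt_trans ltr01).
Unshelve. all: by end_near. Qed.

Lemma cvg_spatial_scale : r (t k) @[k --> \oo] --> +oo.
Proof.
have lr : ln (r (t k)) @[k --> \oo] --> +oo.
  have := cvg_mul_pinfty ltr01 cvg_ln_scale L_oo.
  apply: cvg_trans; apply: near_eq_cvg; near=> k.
  have et : expR 1 < t k by near: k; exact: near_gte.
  have [t0 lt1 llt0] := lnln_gt0 et.
  by rewrite divfK// gt_eqF// (lt_trans ltr01).
apply/cvgryPge => A; near=> k.
have et : expR 1 < t k by near: k; exact: near_gte.
have lk : A <= ln (r (t k)) by near: k; exact: cvgry_ge.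
have r0 := spatial_scale_gt0 et.
apply: (le_trans lk); have := @le_ln1Dx R (r (t k) - 1).
by rewrite (addrC 1) subrK => h; apply: (le_trans (h _)); lra.
Unshelve. all: by end_near. Qed.

(** The penalty at distance r, in units of the height u_v. *)
Definition relative_slope v k := slope (t k) * r (t k) / level v (t k).

(** Here the exponent of the limit rate arises: with s the [log_level], the left side equals (s / ln
    t)^(1 - 1/gamma), and s / ln t tends to d. *)
Lemma cvg_rate v :
  gamma * log_level v (t k) * relative_slope v k @[k --> \oo] --> kappa.
Proof.
have := cvg_powR_base (g := 1 - gamma^-1) d0 (@cvg_log_level_ratio v).
apply: cvg_trans; apply: near_eq_cvg; near=> k.
have et : expR 1 < t k by near: k; exact: near_gte.
have s0 : 0 < log_level v (t k) by near: k; apply: cvgry_gt; exact: cvg_log_level.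
have [t0 lt1 llt0] := lnln_gt0 et; have l0 := lt_trans ltr01 lt1.
rewrite /relative_slope slope_scale// /level.
have pE (x a : R) : 0 < x -> x `^ a = expR (a * ln x) by move=> x0; rewrite /powR gt_eqF.
rewrite !pE ?divr_gt0// ln_div ?posrE//.
transitivity (expR (ln (log_level v (t k))) * expR ((gamma^-1 - 1) * ln (ln (t k))) /
    expR (gamma^-1 * ln (log_level v (t k)))).
  by rewrite -expRN -!expRD; congr expR; ring.
by rewrite lnK ?posrE//; field; rewrite !gt_eqF ?expR_gt0.
Unshelve. all: by end_near. Qed.

Lemma cvg_relative_slope v : relative_slope v k @[k --> \oo] --> 0.
Proof.
have sV : (gamma * log_level v (t k))^-1 @[k --> \oo] --> 0.
  apply: cvg_inv_pinfty.
  by apply: (cvg_mul_pinfty gamma0); [exact: cvg_cst|exact: cvg_log_level].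
have : (gamma * log_level v (t k))^-1 *
    (gamma * log_level v (t k) * relative_slope v k) @[k --> \oo] --> 0 * kappa.
  by apply: cvgM => //; exact: cvg_rate.
rewrite mul0r; apply: cvg_trans; apply: near_eq_cvg; near=> k.
have s0 : 0 < log_level v (t k) by near: k; apply: cvgry_gt; exact: cvg_log_level.
by rewrite /= mulKf// mulf_neq0 ?gt_eqF.
Unshelve. all: by end_near. Qed.

End scaling.

(** * Pointwise limit and uniform bound for the scaled tail *)

Section tail_asymptotics.
Context (R : realType) (d : nat) (gamma : R) (t : R^nat).
Hypotheses (hd : (1 <= d)%N) (gamma0 : 0 < gamma) (t_oo : t @ \oo --> +oo).
Implicit Types v m : R.

Notation r := (spatial_scale gamma).
Notation kappa := (limit_rate d gamma).

(** The raised height is u_v (1 + y), whose power gamma is s (1 + y)^gamma, and r^d exp(- s) = v.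
    The quantifier over m stands inside [\near], which gives the uniformity in the distance required
    for domination. *)
Lemma scaled_tailE v : 0 < v -> \forall k \near \oo, forall m, 0 <= m ->
  let y := relative_slope d gamma t v k * (m / r (t k)) in
  0 <= y /\ r (t k) ^+ d * weibull_tail gamma (level d gamma v (t k) + slope gamma (t k) * m) =
  v * expR (- (log_level d gamma v (t k) * ((1 + y) `^ gamma - 1))).
Proof.
move=> v0; near=> k.
have et : expR 1 < t k by near: k; exact: near_gte.
have s0 : 0 < log_level d gamma v (t k).
  by near: k; apply: cvgry_gt; exact: cvg_log_level.
have r0 := spatial_scale_gt0 gamma et; have c0 := slope_gt0 gamma0 et.
move=> m m0; set y := relative_slope _ _ _ _ _ * _.
have u0 : 0 < level d gamma v (t k) by exact: powR_gt0.
have y0 : 0 <= y.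
  apply: mulr_ge0; last by rewrite divr_ge0 ?(ltW r0).
  by apply: divr_ge0; [exact/ltW/mulr_gt0|exact: ltW].
split => //.
have -> : level d gamma v (t k) + slope gamma (t k) * m = level d gamma v (t k) * (1 + y).
  by rewrite /y /relative_slope; field; rewrite !gt_eqF.
rewrite -{2}(weibull_tail_level (d := d) gamma0 v0 et (ltW s0)) -mulrA; congr (_ * _).
rewrite /weibull_tail powRM ?(ltW u0) ?addr_ge0// -expRD; congr expR.
by rewrite -!powRrM mulVf ?gt_eqF// powRr1 ?ltW//; ring.
Unshelve. all: by end_near. Qed.

(** With w = s gamma y -> kappa rho and y -> 0, the exponent s ((1 + y)^gamma - 1) is squeezed
    between w / (1 + y) and w (1 + y)^gamma. *)
Lemma cvg_scaled_tail v (m : R^nat) (rho : R) : 0 < v -> (forall k, 0 <= m k) ->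
  m k / r (t k) @[k --> \oo] --> rho ->
  r (t k) ^+ d * weibull_tail gamma (level d gamma v (t k) + slope gamma (t k) * m k)
    @[k --> \oo] --> v * expR (- (kappa * rho)).
Proof.
move=> v0 m0 mrho.
pose y k := relative_slope d gamma t v k * (m k / r (t k)).
pose w k := gamma * log_level d gamma v (t k) * relative_slope d gamma t v k *
  (m k / r (t k)).
have wk : w k @[k --> \oo] --> kappa * rho.
  by apply: cvgM => //; exact: cvg_rate.
have y1 : 1 + y k @[k --> \oo] --> (1 : R).
  have : 1 + y k @[k --> \oo] --> 1 + 0 * rho.
    apply: cvgD; first exact: cvg_cst.
    by apply: cvgM => //; exact: cvg_relative_slope.
  by rewrite mul0r addr0.
have y_ge0 : \forall k \near \oo, 0 <= y k.
  by apply: filterS (scaled_tailE v0) => k /(_ _ (m0 k)) [].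
have Ek : log_level d gamma v (t k) * ((1 + y k) `^ gamma - 1) @[k --> \oo] --> kappa * rho.
  apply: (@squeeze_cvgr _ _ _ _ (fun k => w k * (1 + y k)^-1)
      (fun k => w k * (1 + y k) `^ gamma)).
  - near=> k.
    have y0 : 0 <= y k by near: k; exact: y_ge0.
    have s0 : 0 < log_level d gamma v (t k).
      by near: k; apply: cvgry_gt; exact: cvg_log_level.
    have -> : w k = log_level d gamma v (t k) * (gamma * y k) by rewrite /w /y; ring.
    rewrite -!(mulrA (log_level _ _ _ _)); apply/andP; split; rewrite ler_wpM2l ?(ltW s0)//.
      rewrite lerBrDl; apply: le_trans (powR1D_ge gamma y0).
      by rewrite lerD2l -mulrA ler_wpM2l ?(ltW gamma0)// ln1D_ge.
    by rewrite lerBlDl powR1D_le.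
  - have : w k * (1 + y k)^-1 @[k --> \oo] --> kappa * rho * 1^-1.
      by apply: cvgM => //; apply: cvgV => //; exact: oner_neq0.
    by rewrite invr1 mulr1.
  - have : w k * (1 + y k) `^ gamma @[k --> \oo] --> kappa * rho * 1 `^ gamma.
      by apply: cvgM => //; exact: cvg_powR_base.
    by rewrite powR1 mulr1.
have : v * expR (- (log_level d gamma v (t k) * ((1 + y k) `^ gamma - 1)))
    @[k --> \oo] --> v * expR (- (kappa * rho)).
  apply: cvgMl_tmp; apply: continuous_cvg; first exact: continuous_expR.
  exact: cvgN.
apply: cvg_trans; apply: near_eq_cvg.
by apply: filterS (scaled_tailE v0) => k /(_ _ (m0 k)) /= [_ ->].
Unshelve. all: by end_near. Qed.

(** A polynomial bound of degree 2 d in the distance is integrable over R^d and holds for every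
    gamma, since (1 + y)^gamma - 1 >= gamma ln(1 + y) and s is eventually large. *)
Lemma scaled_tail_le v : 0 < v -> \forall k \near \oo, forall m, 0 <= m ->
  r (t k) ^+ d * weibull_tail gamma (level d gamma v (t k) + slope gamma (t k) * m) <=
  v / (1 + kappa / (4 * d%:R) * (m / r (t k))) ^+ (2 * d).
Proof.
move=> v0.
have d0 : 0 < d%:R :> R by rewrite ltr0n.
have k0 : 0 < kappa by exact: limit_rate_gt0.
near=> k => m m0.
have et : expR 1 < t k by near: k; exact: near_gte.
have s0 : 0 < log_level d gamma v (t k).
  by near: k; apply: cvgry_gt; exact: cvg_log_level.
have s1 : 2 * d%:R / gamma <= log_level d gamma v (t k).
  by near: k; apply: cvgry_ge; exact: cvg_log_level.
have rk : kappa / 2 <= gamma * log_level d gamma v (t k) * relative_slope d gamma t v k.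
  by near: k; apply: (cvgr_ge kappa); [exact: cvg_rate|lra].
have r0 := spatial_scale_gt0 gamma et.
have [] : let y := relative_slope d gamma t v k * (m / r (t k)) in
  0 <= y /\ r (t k) ^+ d * weibull_tail gamma (level d gamma v (t k) + slope gamma (t k) * m) =
  v * expR (- (log_level d gamma v (t k) * ((1 + y) `^ gamma - 1))).
  by move: m m0; near: k; exact: scaled_tailE.
set y := relative_slope _ _ _ _ _ * _ => y0 ->.
set s := log_level d gamma v (t k) in s0 s1 rk *.
have mr0 : 0 <= m / r (t k) by apply: divr_ge0 => //; exact: ltW.
have k4 : 0 <= kappa / (4 * d%:R) by apply: divr_ge0; [exact: ltW|rewrite mulr_ge0].
rewrite ler_wpM2l ?(ltW v0)// expRN lef_pV2 ?posrE ?expR_gt0 ?exprn_gt0//; last first.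
  by rewrite ltr_pwDl// mulr_ge0.
set z := kappa / (4 * d%:R) * (m / r (t k)).
have z0 : 0 <= z.
  by rewrite /z mulr_ge0.
have z1 : 0 < 1 + z by lra.
(* As s gamma ln(1 + y) = 2 d p ln(1 + y), the logarithmic Bernoulli inequality yields the power 2 d
   of 1 + p y. The bound [s1] makes p >= 1, and [rk] makes p y at least z, whence the constant kappa
   / (4 d). *)
pose p := gamma * s / (2 * d%:R).
have p1 : 1 <= p.
  rewrite /p ler_pdivlMr ?mulr_gt0// mul1r.
  by rewrite -ler_pdivrMl// mulrC.
have zp : z <= p * y.
  rewrite /z /y [leRHS]mulrA ler_wpM2r//.
  have -> : p * relative_slope d gamma t v k =
      gamma * s * relative_slope d gamma t v k / (2 * d%:R).
    by rewrite /p; field; rewrite gt_eqF.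
  have -> : kappa / (4 * d%:R) = kappa / 2 / (2 * d%:R) by field; rewrite gt_eqF.
  by rewrite ler_wpM2r// invr_ge0 mulr_ge0// ltW.
rewrite -[X in X ^+ _ <= _]lnK ?posrE// -expRM_natl ler_expR.
have h1 : ln (1 + z) <= p * ln (1 + y).
  apply: le_trans (ln1DM_le p1 y0); rewrite ler_ln ?posrE ?lerD2l//.
  by lra.
have h2 : s * (gamma * ln (1 + y)) <= s * ((1 + y) `^ gamma - 1).
  by rewrite ler_wpM2l ?(ltW s0)// lerBrDl powR1D_ge.
apply: le_trans h2; rewrite natrM.
have -> : s * (gamma * ln (1 + y)) = (2 * d%:R) * (p * ln (1 + y)).
  by rewrite /p; field; rewrite gt_eqF.
by rewrite ler_wpM2l// mulr_ge0// ltW.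
Unshelve. all: by end_near. Qed.

End tail_asymptotics.

(** * Dominated convergence for the expected number of exceedances *)

Lemma near_dominated_cvg d (T : measurableType d) (R : realType)
    (mu : {measure set T -> \bar R}) (f_ : nat -> T -> R) (f g : T -> R) :
  (\forall n \near \oo, measurable_fun setT (f_ n) /\ forall x, `|f_ n x| <= g x) ->
  (forall x, f_ n x @[n --> \oo] --> f x) ->
  mu.-integrable setT (EFin \o g) ->
  (\int[mu]_x (f_ n x)%:E @[n --> \oo] --> \int[mu]_x (f x)%:E)%E.
Proof.
move=> [N _ HN] f_f ig; rewrite -(cvg_shiftn N).
apply: (@dominated_cvg _ _ _ mu setT measurableT
  (fun n x => (f_ (n + N)%N x)%:E) _ (EFin \o g)).
- by move=> n; apply/measurable_EFinP; have [] := HN _ (leq_addl n N).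
- move=> x _; apply: cvg_EFin; first exact: nearW.
  by have := f_f x; rewrite -(cvg_shiftn N).
- by [].
- by [].
- by move=> n x _; rewrite lee_fin; have [_] := HN _ (leq_addl n N).
Qed.

Section dominating.
Context (R : realType).

Lemma integral_oneDsqrV :
  (\int[lebesgue_measure]_x ((1 + (x : R) ^+ 2)^-1)%:E = pi%:E)%E.
Proof.
rewrite (@ge0_symfun_integralT _ (fun x => (1 + x ^+ 2)^-1)).
- rewrite -set_itvcy integral0y_oneDsqr -EFinM; congr (_%:E).
  by rewrite mulrC divfK.
- by move=> x; rewrite invr_ge0 addr_ge0// sqr_ge0.
- exact: continuous_oneDsqrV.
- by move=> x /=; rewrite sqrrN.
Qed.

Lemma integrable_row_prod_oneDsqrV n (v C : R) : 0 <= v -> 0 <= C ->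
  (lebesgue_row R n).-integrable setT
    (EFin \o (fun x : 'rV[R]_n => v * \prod_(i < n) (C * (1 + x ord0 i ^+ 2)^-1))).
Proof.
move=> v0 C0; pose h (a : R) := C * (1 + a ^+ 2)^-1.
have h0 a : 0 <= h a by rewrite mulr_ge0// invr_ge0 addr_ge0// sqr_ge0.
have mV : measurable_fun setT (fun a : R => (1 + a ^+ 2)^-1).
  by apply: continuous_measurable_fun; exact: continuous_oneDsqrV.
have mh : measurable_fun setT h by exact: measurable_funM.
have mp : measurable_fun setT (fun x : 'rV[R]_n => \prod_(i < n) h (x ord0 i)).
  exact: (@measurable_row_prod _ _ (fun=> h)).
apply/integrableP; split; first by apply/measurable_EFinP; exact: measurable_funM.
rewrite [X in (X < _)%E](_ : _ = \int[lebesgue_row R n]_x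
    (v%:E * (\prod_(i < n) h (x ord0 i))%:E))%E; last first.
  apply: eq_integral => x _; rewrite abse_EFin ger0_norm ?EFinM//.
  by rewrite mulr_ge0// prodr_ge0// => i _; exact: h0.
rewrite ge0_integralZl_EFin//; last 2 first.
  by move=> x _; rewrite lee_fin prodr_ge0.
  exact/measurable_EFinP.
rewrite (@integral_row_prod _ _ (fun=> h))//.
rewrite (eq_bigr (fun=> (C * pi)%:E)) => [|i _].
  by rewrite prodEFin -EFinM ltry.
under eq_integral do rewrite EFinM.
rewrite ge0_integralZl_EFin//; last 2 first.
  by move=> x _; rewrite lee_fin invr_ge0 addr_ge0// sqr_ge0.
  exact/measurable_EFinP.
by rewrite integral_oneDsqrV.
Qed.

End dominating.

Section exceedance.
Context (R : realType) (d : nat) (gamma : R) (t : R^nat).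
Hypotheses (hd : (1 <= d)%N) (gamma0 : 0 < gamma) (t_oo : t @ \oo --> +oo).

Notation r := (spatial_scale gamma).
Notation kappa := (limit_rate d gamma).

Definition cell_norm k (x : 'rV[R]_d) : R := (l1norm (cell (r (t k)) x))%:~R.

Lemma cell_normE k x : cell_norm k x = \sum_(i < d) `|(cell (r (t k)) x ord0 i)%:~R|.
Proof. by rewrite /cell_norm /l1norm rmorph_sum/=; apply: eq_bigr => i _; rewrite intr_norm. Qed.

Lemma cell_norm_ge0 k x : 0 <= cell_norm k x.
Proof. by rewrite cell_normE sumr_ge0. Qed.

Lemma cvg_cell_norm x : cell_norm k x / r (t k) @[k --> \oo] --> l1norm x.
Proof.
have roo : r (t k) @[k --> \oo] --> +oo by exact: cvg_spatial_scale.
have : \sum_(i < d) `|(cell (r (t k)) x ord0 i)%:~R / r (t k)| @[k --> \oo] --> l1norm x.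
  apply: cvg_big => [|i _]; first exact: add_continuous.
  apply: cvg_norm.
  apply/cvgrPdist_le => e e0; near=> k.
  have r0 : 0 < r (t k) by near: k; exact: cvgry_gt.
  rewrite distrC; apply: (le_trans (dist_cell x i r0)).
  by rewrite invf_ple ?posrE//; near: k; exact: cvgry_ge.
apply: cvg_trans; apply: near_eq_cvg; near=> k.
have r0 : 0 < r (t k) by near: k; exact: cvgry_gt.
rewrite cell_normE mulr_suml; apply: eq_bigr => i _.
by rewrite normrM normfV (gtr0_norm r0).
Unshelve. all: by end_near. Qed.

Definition scaled_tail v k x :=
  r (t k) ^+ d * weibull_tail gamma (level d gamma v (t k) + slope gamma (t k) * cell_norm k x).

Lemma cvg_scaled_tail_cell v x : 0 < v ->
  scaled_tail v k x @[k --> \oo] --> v * expR (- (kappa * l1norm x)).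
Proof.
move=> v0; apply: cvg_scaled_tail => //; last exact: cvg_cell_norm.
by move=> k; exact: cell_norm_ge0.
Qed.

Lemma measurable_cell_comp k (g : 'rV[int]_d -> R) : 0 < r (t k) ->
  measurable_fun setT (g \o cell (r (t k))).
Proof.
move=> r0; apply: (measurable_countable_comp _ (g : _ -> measurableTypeR R)).
by move=> z; exact: measurable_cell.
Qed.

Lemma scaled_tail_ge0 v k x : 0 < r (t k) -> 0 <= scaled_tail v k x.
Proof. by move=> r0; rewrite mulr_ge0 ?expR_ge0// exprn_ge0// ltW. Qed.

(** Power 2 d of 1 + b |x| dominates the product over the coordinates of (1 + b |x_i|)^2, which
    splits the dominating function into integrable one-dimensional factors. *)
Lemma scaled_tail_dominated v : 0 < v -> exists2 C, 0 <= C &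
  \forall k \near \oo, forall x, scaled_tail v k x <=
    v * \prod_(i < d) (C * (1 + x ord0 i ^+ 2)^-1).
Proof.
move=> v0; have d0 : 0 < d%:R :> R by rewrite ltr0n.
have k0 : 0 < kappa by exact: limit_rate_gt0.
pose b := kappa / (4 * d%:R).
have b0 : 0 < b by rewrite divr_gt0// mulr_gt0.
(* One constant below both 1 and b gives 1/2 + b |x_i| >= (e / 2) (1 + |x_i|); squaring produces C =
   4 / e^2. *)
pose e := Num.min 1 b.
have e0 : 0 < e by rewrite lt_min ltr01.
have e1 : e <= 1 by rewrite ge_min lexx.
have eb : e <= b by rewrite ge_min lexx orbT.
exists (4 / e ^+ 2); first by rewrite divr_ge0// sqr_ge0.
have roo : r (t k) @[k --> \oo] --> +oo by exact: cvg_spatial_scale.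
near=> k => x.
have r0 : 0 < r (t k) by near: k; exact: cvgry_gt.
(* Rounding to a cell moves a coordinate by at most 1/r, which then costs at most 1/2 after
   multiplication by b. *)
have rb : 2 * b <= r (t k) by near: k; exact: cvgry_ge.
apply: (@le_trans _ _ (v / (1 + b * (cell_norm k x / r (t k))) ^+ (2 * d))).
  rewrite /scaled_tail; have := cell_norm_ge0 k x; move: (cell_norm k x) => m.
  by move: m; near: k; exact: scaled_tail_le.
rewrite ler_wpM2l ?(ltW v0)//.
pose rho i := `|(cell (r (t k)) x ord0 i)%:~R| / r (t k).
have rho0 i : 0 <= rho i by rewrite divr_ge0// ltW.
have -> : cell_norm k x / r (t k) = \sum_(i < d) rho i by rewrite cell_normE mulr_suml.
have rhox i : `|x ord0 i| - (r (t k))^-1 <= rho i.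
  rewrite lerBlDl -lerBlDr /rho -[X in _ / X](gtr0_norm r0) -normf_div.
  by rewrite (le_trans (lerB_dist _ _))// distrC dist_cell.
have f0 i : 0 < 1 + x ord0 i ^+ 2 by rewrite ltr_pwDl// sqr_ge0.
have brho0 i : 0 <= b * rho i by rewrite mulr_ge0// ltW.
have bound i : e ^+ 2 / 4 * (1 + x ord0 i ^+ 2) <= (1 + b * rho i) ^+ 2.
  have h : e / 2 * (1 + `|x ord0 i|) <= 1 + b * rho i.
    have : b * (`|x ord0 i| - (r (t k))^-1) <= b * rho i by rewrite ler_wpM2l// ltW.
    have : b * (r (t k))^-1 <= 1 / 2 by rewrite ler_pdivrMr//; lra.
    have : e * `|x ord0 i| <= b * `|x ord0 i| by rewrite ler_wpM2r.
    by have := normr_ge0 (x ord0 i); nra.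
  apply: (@le_trans _ _ ((e / 2 * (1 + `|x ord0 i|)) ^+ 2)).
    rewrite exprMn expr_div_n -natrX ler_wpM2l ?divr_ge0 ?sqr_ge0//.
    by rewrite -(real_normK (num_real (x ord0 i))); have := normr_ge0 (x ord0 i); nra.
  by rewrite ler_pXn2r// nnegrE ?(le_trans _ h) ?mulr_ge0 ?addr_ge0 ?divr_ge0// ltW.
have prodS : \prod_(i < d) (1 + b * rho i) <= (1 + b * \sum_(i < d) rho i) ^+ d.
  rewrite [leRHS](_ : _ = \prod_(i < d) (1 + b * \sum_(i < d) rho i)); last first.
    by rewrite prodr_const card_ord.
  apply: ler_prod => i _.
  rewrite addr_ge0//= lerD2l ler_wpM2l ?(ltW b0)// (bigD1 i)//= lerDl.
  by rewrite sumr_ge0.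
rewrite -[leRHS]invrK lef_pV2 ?posrE; last 2 first.
- by rewrite exprn_gt0// ltr_pwDl// mulr_ge0 ?sumr_ge0// ltW.
- by rewrite invr_gt0 prodr_gt0// => i _; rewrite mulr_gt0 ?invr_gt0// divr_gt0// exprn_gt0.
rewrite mulnC exprM -prodfV.
apply: (@le_trans _ _ ((\prod_(i < d) (1 + b * rho i)) ^+ 2)).
  rewrite -prodrXl; apply: ler_prod => i _.
  rewrite invr_ge0 mulr_ge0 ?invr_ge0 ?(ltW (f0 i)) ?divr_ge0 ?sqr_ge0//=.
  by rewrite invfM invrK invf_div.
by rewrite ler_pXn2r// nnegrE ?prodr_ge0 ?exprn_ge0 ?addr_ge0 ?mulr_ge0 ?sumr_ge0//
  ?ltW// => i _; rewrite addr_ge0.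
Unshelve. all: by end_near. Qed.

(** The integral of exp(- kappa |x|) over R^d, the constant lambda. *)
Definition exceedance_rate : R := (2 / kappa) ^+ d.

(** The integral is the sum over all sites z of the tail at u_v + c |z|, that is, eventually, the
    expected number of sites with [Psi] at least u_v. *)
Lemma cvg_integral_scaled_tail v : 0 < v ->
  (\int[lebesgue_row R d]_x (scaled_tail v k x)%:E @[k --> \oo] -->
   (exceedance_rate * v)%:E)%E.
Proof.
move=> v0; have k0 : 0 < kappa by exact: limit_rate_gt0.
have [C C0 domC] := scaled_tail_dominated v0.
have roo : r (t k) @[k --> \oo] --> +oo by exact: cvg_spatial_scale.
have -> : (exceedance_rate * v)%:E =
    (\int[lebesgue_row R d]_x (v * expR (- (kappa * l1norm x)))%:E)%E.
  have pE (x : 'rV[R]_d) :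
      v * expR (- (kappa * l1norm x)) = (exceedance_rate * v) * laplace_row_pdf kappa x.
    rewrite laplace_row_pdfE /exceedance_rate -(invf_div kappa) exprVn.
    by field; rewrite !gt_eqF// exprn_gt0// divr_gt0.
  under eq_integral do rewrite pE EFinM.
  rewrite ge0_integralZl_EFin//.
  - by rewrite integral_laplace_row// mule1.
  - by move=> x _; rewrite lee_fin ltW// laplace_row_pdf_gt0.
  - by apply/measurable_EFinP; exact: measurable_laplace_row_pdf.
  - by rewrite mulr_ge0 ?(ltW v0)// exprn_ge0// divr_ge0// ltW.
apply: near_dominated_cvg (integrable_row_prod_oneDsqrV d (ltW v0) C0).
- near=> k.
  have r0 : 0 < r (t k) by near: k; exact: cvgry_gt.
  split.
    exact: (@measurable_cell_comp k (fun z => r (t k) ^+ d * weibull_tail gamma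
      (level d gamma v (t k) + slope gamma (t k) * (l1norm z)%:~R))).
  move=> x; rewrite ger0_norm ?scaled_tail_ge0//.
  by move: x; near: k; exact: domC.
- by move=> x; exact: cvg_scaled_tail_cell.
Unshelve. all: by end_near. Qed.

End exceedance.

(** * The location of the maximiser *)

Section countable_intersection.
Context d (T : measurableType d) (R : realType) (P : probability T R) (K : countType).

(** Independence speaks of finite families; continuity from above along the families of elements
    with code below n carries a uniform lower bound to the countable intersection. *)
Lemma probability_bigcap_ge (B : K -> set T) (e : \bar R) :
  (forall i, measurable (B i)) ->
  (forall J : seq K, uniq J -> (e <= P (\bigcap_(i in [set` J]) B i))%E) ->
  (e <= P (\bigcap_i B i))%E.
Proof.
move=> mB eB; pose J n := undup (pmap (@unpickle K) (iota 0 n)).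
pose F n := \bigcap_(i in [set` J n]) B i.
have JP i : i \in J (pickle i).+1.
  rewrite mem_undup mem_pmap; apply/mapP; exists (pickle i); last by rewrite pickleK.
  by rewrite mem_iota add0n leqnn.
have mF n : measurable (F n) by apply: fin_bigcap_measurable => //; exact: finite_seq.
have FE : \bigcap_n F n = \bigcap_i B i.
  apply/seteqP; split => x Fx i //; last by move=> _ j _; exact: Fx.
  by move=> _; apply: (Fx (pickle i).+1) => //; exact: JP.
rewrite -FE; have : P \o F @ \oo --> P (\bigcap_n F n).
  apply: nonincreasing_cvg_mu => //.
  - by rewrite (le_lt_trans (probability_le1 P (mF 0%N)))// ltry.
  - exact: bigcapT_measurable.
  - move=> n m nm; apply/subsetPset => x Fx i /= iJ; apply: Fx => /=.
    move: iJ; rewrite !mem_undup !mem_pmap => /mapP[j jn ->].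
    apply: map_f; move: jn; rewrite !mem_iota !add0n => /leq_trans; exact.
move=> cF; rewrite -(cvg_lim _ cF)//; apply: lime_ge.
  by apply/cvg_ex; eexists; exact: cF.
by apply: nearW => n; apply: eB; exact: undup_uniq.
Qed.

End countable_intersection.

Section independent_maximum.
Context d (T : measurableType d) (R : realType) (P : probability T R).

(** From 1 / (1 - q) = 1 + q / (1 - q) <= exp(q / (1 - q)), each factor is at least exp(- q / (1 -
    Q)). *)
Lemma prod_onem_ge (I : eqType) (s : seq I) (q : I -> R) (Q N : R) :
  (forall i, 0 <= q i <= Q) -> Q < 1 -> \sum_(i <- s) q i <= N ->
  expR (- (N / (1 - Q))) <= \prod_(i <- s) (1 - q i).
Proof.
move=> q0 Q1 sN; have Q0 : 0 < 1 - Q by rewrite subr_gt0.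
apply: (@le_trans _ _ (expR (- (\sum_(i <- s) q i / (1 - Q))))).
  by rewrite ler_expR lerN2 -mulr_suml ler_wpM2r// invr_ge0 ltW.
rewrite -sumrN expR_sum; apply: ler_prod => i _; rewrite expR_ge0/=.
have /andP[qi0 qiQ] := q0 i; have qi1 : 0 < 1 - q i by lra.
apply: (@le_trans _ _ (expR (- (q i / (1 - q i))))).
  by rewrite ler_expR lerN2 ler_wpM2l// lef_pV2 ?posrE// lerD2l lerN2.
rewrite [leRHS](_ : _ = (1 + q i / (1 - q i))^-1); last by field; lra.
rewrite expRN lef_pV2 ?posrE ?expR_gt0 ?expR_ge1Dx//.
by rewrite ltr_pwDl// divr_ge0// ltW.
Qed.

Lemma strict_maximum_bigcap (K : countType) (X : K -> T -> R) (z : K) (A : set R)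
    (a : K -> R) :
  [set w | A (X z w) /\ forall y, y != z -> X y w < a y] =
  \bigcap_y (X y @^-1` (if y == z then A else [set x | x < a y])).
Proof.
apply/seteqP; split => w /=.
  by move=> [Az h] y _ /=; case: eqP => [->//|/eqP /h].
move=> h; split; first by have := h z Logic.I; rewrite /= eqxx.
by move=> y /negbTE yz; have := h y Logic.I; rewrite /= yz.
Qed.

Lemma measurable_strict_maximum (K : countType) (X : K -> {RV P >-> R}) (z : K)
    (A : set R) (a : K -> R) : measurable A ->
  measurable [set w | A (X z w) /\ forall y, y != z -> X y w < a y].
Proof.
move=> mA; rewrite strict_maximum_bigcap.
rewrite -[X in measurable X]setCK setC_bigcap; apply: measurableC.
apply: countable_bigcupT_measurable; first exact: countableP.
move=> y; apply: measurableC; apply: measurable_funPTI; case: eqP => // _.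
by rewrite -set_itvNyo; exact: measurable_itv.
Qed.

Lemma independent_strict_maximum_ge (K : countType) (X : K -> {RV P >-> R})
    (z : K) (A : set R) (a : K -> R) (p Q N : R) (q : K -> R) :
  mutually_independent P (fun y => X y : T -> R) ->
  measurable A -> P (X z @^-1` A) = p%:E ->
  (forall y, P [set w | X y w < a y] = (1 - q y)%:E) ->
  (forall y, 0 <= q y <= Q) -> Q < 1 ->
  (forall J : seq K, uniq J -> \sum_(y <- J) q y <= N) ->
  ((p * expR (- (N / (1 - Q))))%:E <=
   P [set w | A (X z w) /\ forall y, y != z -> (X y w < a y)%R])%E.
Proof.
move=> indep mA pz Pq q0 Q1 sN.
pose C y : set R := if y == z then A else [set x | x < a y].
have mC y : measurable (C y).
  rewrite /C; case: eqP => // _; rewrite -set_itvNyo; exact: measurable_itv.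
have mXC y : measurable (X y @^-1` C y) by exact: measurable_funPTI.
have p0 : 0 <= p by rewrite -lee_fin -pz.
rewrite strict_maximum_bigcap; apply: probability_bigcap_ge => // J uJ.
(* Adjoining z to the list only shrinks the intersection, and makes the factor p appear exactly
   once. *)
apply: (@le_trans _ _ (P (\bigcap_(y in [set` z :: rem z J]) (X y @^-1` C y)))).
  rewrite (indep (z :: rem z J) C)//; last by rewrite /= rem_uniq// andbT mem_rem_uniqF.
  rewrite big_cons /C eqxx pz.
  rewrite (eq_big_seq (fun y => (1 - q y)%:E)); last first.
    move=> y; rewrite mem_rem_uniq// inE => /andP[/negbTE -> _]; exact: Pq.
  rewrite prodEFin -EFinM lee_fin ler_wpM2l// prod_onem_ge//.
  by apply: sN; rewrite rem_uniq.
rewrite le_measure ?inE//; try (apply: fin_bigcap_measurable => //; exact: finite_seq).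
move=> w h y /= yJ; apply: h => /=.
by rewrite inE; case: eqVneq => //= yz; rewrite mem_rem_uniq// inE yz.
Qed.

End independent_maximum.

Lemma le_probability_ae d (T : measurableType d) (R : realType) (P : probability T R)
    (A B : set T) : measurable A -> measurable B ->
  {ae P, forall w, A w -> B w} -> (P A <= P B)%E.
Proof.
move=> mA mB [N [mN PN0 sN]].
apply: (@le_trans _ _ (P (B `|` N))).
  rewrite le_measure ?inE//; first exact: measurableU.
  move=> w Aw; have [Bw|nBw] := pselect (B w); first by left.
  by right; apply: sN => /= /(_ Aw).
apply: (le_trans (measureU2 _ mB mN)).
by rewrite [X in (_ + X)%E](_ : _ = 0%E) ?adde0//.
Qed.

(** * Lower bound for the probability that a given site is the maximiser *)

Section argmax.
Context (R : realType) (d : nat) (gamma : R) (gamma0 : 0 < gamma)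
  (dO : measure_display) (Omega : measurableType dO) (P : probability Omega R)
  (xi : 'rV[int]_d -> {RV P >-> R})
  (xi_indep : mutually_independent P (fun z => xi z : Omega -> R))
  (xi_weibull : forall z, weibull_distributed P gamma (xi z))
  (Z : R -> Omega -> 'rV[int]_d)
  (Z_meas : forall t, expR 1 < t -> forall z, measurable (Z t @^-1` [set z]))
  (Z_max : forall t, expR 1 < t ->
      {ae P, forall w,
        (exists z, is_maximiser (Psi gamma (xi ^~ w) t) z) ->
        is_maximiser (Psi gamma (xi ^~ w) t) (Z t w)}).

Notation F := (weibull_tail gamma).

Lemma weibull_tail_ge0 (a : R) : 0 <= F a. Proof. exact: expR_ge0. Qed.

Lemma weibull_tail_lt1 (a : R) : 0 < a -> F a < 1.
Proof. by move=> a0; rewrite /weibull_tail expR_lt1 oppr_lt0 powR_gt0. Qed.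

Lemma le_weibull_tail (a b : R) : 0 <= a -> a <= b -> F b <= F a.
Proof.
move=> a0 ab; rewrite ler_expR lerN2; apply: ge0_ler_powR => //; first exact: ltW.
by rewrite nnegrE (le_trans a0).
Qed.

Lemma weibull_lt z (a : R) : 0 <= a -> P [set w | xi z w < a] = (1 - F a)%:E.
Proof. exact: xi_weibull. Qed.

Lemma weibull_itv z (a b : R) : 0 <= a -> a <= b ->
  P (xi z @^-1` `[a, b[%classic) = (F a - F b)%:E.
Proof.
move=> a0 ab; have mlt e : measurable [set w | xi z w < e].
  rewrite (_ : [set w | _] = xi z @^-1` `]-oo, e[%classic).
    exact: measurable_funPTI.
  by apply/seteqP; split => w /=; rewrite in_itv.
have mitv : measurable (xi z @^-1` `[a, b[%classic) by exact: measurable_funPTI.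
have := weibull_lt z (le_trans a0 ab).
rewrite (_ : [set w | _] = [set w | xi z w < a] `|` xi z @^-1` `[a, b[%classic); last first.
  apply/seteqP; split => w /=; rewrite in_itv/=.
    by move=> wb; have [wa|aw] := ltP (xi z w) a; [left|right; rewrite wb].
  by case=> [/lt_le_trans|/andP[_]//]; exact.
rewrite measureU//; last first.
  apply/seteqP; split => // w /= []; rewrite in_itv/= => wa /andP[/le_lt_trans /(_ wa)].
  by rewrite ltxx.
rewrite [X in (X + _)%E](weibull_lt z a0).
set p := (X in (_ + X)%E) => h; rewrite -[LHS]/p; move: h.
have /fineK <- : p \is a fin_num by exact: (fin_num_measure P).
by rewrite -EFinD => -[h]; congr (_%:E); move: h; lra.
Qed.

Variable t : R.
Hypothesis et : expR 1 < t.

(** The value that the field must reach at z for [Psi] to reach u there. *)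
Definition threshold u (z : 'rV[int]_d) : R := u + slope gamma t * (l1norm z)%:~R.

Lemma l1norm_ge0 (z : 'rV[int]_d) : 0 <= (l1norm z)%:~R :> R.
Proof. by rewrite ler0z sumr_ge0. Qed.

Lemma le_threshold u z : u <= threshold u z.
Proof.
by rewrite lerDl mulr_ge0 ?l1norm_ge0// ltW// slope_gt0.
Qed.

Lemma PsiE w z : Psi gamma (xi ^~ w) t z = xi z w - slope gamma t * (l1norm z)%:~R.
Proof. by rewrite /Psi /slope; congr (_ - _); ring. Qed.

(** In terms of [Psi]: its value at z lies in [u, u') and all its other values lie below u. *)
Definition separated u u' (z : 'rV[int]_d) := [set w |
  `[threshold u z, threshold u' z[%classic (xi z w) /\
  forall y, y != z -> xi y w < threshold u y].

Lemma measurable_separated u u' z : measurable (separated u u' z).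
Proof. exact: measurable_strict_maximum. Qed.

(** On this event z is itself a maximiser, which discharges the existence premise of [Z_max]; it is
    a strict one, which forces Z = z. *)
Lemma separated_argmax u u' z : {ae P, forall w, separated u u' z w -> (Z t @^-1` [set z]) w}.
Proof.
apply: filterS (Z_max et) => w Zmax [/=]; rewrite in_itv/= => /andP[uz _] uy.
have zlt y : y != z -> Psi gamma (xi ^~ w) t y < Psi gamma (xi ^~ w) t z.
  move=> /uy; rewrite !PsiE; move: uz; rewrite /threshold.
  by set p := _ * _; set q := _ * _; lra.
have /Zmax /(_ z) : exists z, is_maximiser (Psi gamma (xi ^~ w) t) z.
  by exists z => y; have [->//|/zlt/ltW] := eqVneq y z.
by have [//|/zlt] := eqVneq (Z t w) z; rewrite ltNge => /negbTE ->.
Qed.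

(** All thresholds are at least u, so [F u] bounds every exceedance probability and plays the part
    of Q in [independent_strict_maximum_ge]. *)
Lemma separated_ge u u' z N : 0 < u -> u <= u' ->
  (forall J : seq 'rV[int]_d, uniq J -> \sum_(y <- J) F (threshold u y) <= N) ->
  (((F (threshold u z) - F (threshold u' z)) * expR (- (N / (1 - F u))))%:E <=
   P (separated u u' z))%E.
Proof.
move=> u0 uu' sN; have u0' y := le_trans (ltW u0) (le_threshold u y).
apply: (independent_strict_maximum_ge (q := fun y => F (threshold u y))) => //.
- by rewrite weibull_itv// lerD2r.
- by move=> y; rewrite weibull_lt.
- by move=> y; rewrite weibull_tail_ge0 le_weibull_tail ?(ltW u0)// le_threshold.
- exact: weibull_tail_lt1.
Qed.

(* The events attached to successive height intervals are disjoint. *)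
Lemma argmax_ge (M : nat) (u : nat -> R) (N : nat -> R) z :
  (forall j, 0 < u j) -> {homo u : i j / (i <= j)%N >-> j <= i} ->
  (forall j (J : seq 'rV[int]_d), uniq J -> \sum_(y <- J) F (threshold (u j) y) <= N j) ->
  ((\sum_(j < M) (F (threshold (u j.+1) z) - F (threshold (u j) z)) *
     expR (- (N j.+1 / (1 - F (u j.+1)))))%:E <= P (Z t @^-1` [set z]))%E.
Proof.
move=> u0 und sN; pose E j := separated (u j.+1) (u j) z.
have mE j : measurable (E j) by exact: measurable_separated.
have tE : trivIset setT E.
  apply/trivIsetP => i j _ _; wlog ij : i j / (i < j)%N.
    move=> h; rewrite neq_ltn => /orP[ij|ji]; first by apply: h => //; rewrite ltn_eqF.
    by rewrite setIC; apply: h => //; rewrite ltn_eqF.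
  move=> _; apply/seteqP; split => // w [[+ _] [+ _]]; rewrite /= !in_itv/=.
  move=> /andP[h1 _] /andP[_ h2]; have := und _ _ ij.
  by move: h1 h2; rewrite /threshold => h1 h2 h3; lra.
apply: (@le_trans _ _ (P (\big[setU/set0]_(j < M) E j))).
  rewrite measure_bigsetU// -sumEFin; apply: lee_sum => j _.
  apply: separated_ge => //; [exact/und/leqnSn|exact: sN].
apply: le_probability_ae => //.
- by apply: bigsetU_measurable.
- exact: Z_meas.
have h : {ae P, forall w, forall j, E j w -> (Z t @^-1` [set z]) w}.
  by apply: ae_foralln => j; exact: separated_argmax.
by apply: filterS h => w h; rewrite -bigcup_mkord => -[j _] /h.
Qed.

End argmax.

(** * The local lower bound: Riemann sums over heights *)

Section local_limit.
Context (R : realType) (d : nat) (gamma : R) (hd : (1 <= d)%N) (gamma0 : 0 < gamma)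
  (dO : measure_display) (Omega : measurableType dO) (P : probability Omega R)
  (xi : 'rV[int]_d -> {RV P >-> R})
  (xi_indep : mutually_independent P (fun z => xi z : Omega -> R))
  (xi_weibull : forall z, weibull_distributed P gamma (xi z))
  (Z : R -> Omega -> 'rV[int]_d)
  (Z_meas : forall t, expR 1 < t -> forall z, measurable (Z t @^-1` [set z]))
  (Z_max : forall t, expR 1 < t ->
      {ae P, forall w,
        (exists z, is_maximiser (Psi gamma (xi ^~ w) t) z) ->
        is_maximiser (Psi gamma (xi ^~ w) t) (Z t w)})
  (t : R^nat) (t_oo : t @ \oo --> +oo).

Notation r := (spatial_scale gamma).
Notation kappa := (limit_rate d gamma).
Notation lambda := (exceedance_rate d gamma).
Notation stail := (@scaled_tail R d gamma t).

(** The density of Z / r after each atom has been spread uniformly over its cell. *)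
Definition local_density k (x : 'rV[R]_d) : R :=
  r (t k) ^+ d * fine (P (Z (t k) @^-1` [set cell (r (t k)) x])).

Definition mean_exceedances v k : R :=
  fine (\int[lebesgue_row R d]_x (stail v k x)%:E)%E.

(** The left side is the integral of the same function over the disjoint union of the cells of
    [J]. *)
Lemma sum_exceedances_le v k (J : seq 'rV[int]_d) : 0 < r (t k) -> uniq J ->
  ((\sum_(y <- J) weibull_tail gamma (threshold gamma (t k) (level d gamma v (t k)) y))%:E <=
   \int[lebesgue_row R d]_x (stail v k x)%:E)%E.
Proof.
move=> r0 uJ; have mcell y := @measurable_cell R d (r (t k)) y r0.
have mst : measurable_fun setT (fun x => (stail v k x)%:E).
  apply/measurable_EFinP; exact: (@measurable_cell_comp _ _ _ _ k
    (fun z => r (t k) ^+ d * weibull_tail gamma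
      (level d gamma v (t k) + slope gamma (t k) * (l1norm z)%:~R))).
have st0 x : (0 <= (stail v k x)%:E)%E by rewrite lee_fin scaled_tail_ge0.
apply: (@le_trans _ _ (\int[lebesgue_row R d]_(x in
    \big[setU/set0]_(y <- J) (cell (r (t k)) @^-1` [set y])) (stail v k x)%:E)%E); last first.
  by apply: ge0_subset_integral => //; exact: bigsetU_measurable.
rewrite ge0_integral_bigsetU//; last 2 first.
- by apply/trivIsetP => y z _ _ yz; apply/seteqP; split => // x [/= ->] /eqP; rewrite (negbTE yz).
- exact: measurable_funTS.
rewrite -sumEFin; apply: lee_sum => y _.
rewrite (_ : (\int[_]_(x in _) _)%E = ((r (t k) ^+ d * weibull_tail gamma
   (threshold gamma (t k) (level d gamma v (t k)) y))%:E * (r (t k) ^- d)%:E)%E).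
  by rewrite -EFinM lee_fin mulrAC divff ?mul1r// gt_eqF// exprn_gt0.
transitivity (\int[lebesgue_row R d]_(x in cell (r (t k)) @^-1` [set y])
    cst (r (t k) ^+ d * weibull_tail gamma
      (threshold gamma (t k) (level d gamma v (t k)) y))%:E x)%E.
  by apply: eq_integral => x; rewrite inE /= => <-.
rewrite integral_cst; last exact: mcell.
by congr (_ * _)%E; exact: lebesgue_row_cell.
Qed.

Lemma cvg_mean_exceedances v : 0 < v ->
  mean_exceedances v k @[k --> \oo] --> lambda * v.
Proof.
by move=> v0; have /fine_cvgP[] := cvg_integral_scaled_tail hd gamma0 t_oo v0.
Qed.

Lemma cvg_level_tail v : 0 < v ->
  weibull_tail gamma (level d gamma v (t k)) @[k --> \oo] --> (0 : R).
Proof.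
move=> v0; rewrite /weibull_tail.
have : expR (- log_level d gamma v (t k)) @[k --> \oo] --> (0 : R).
  under eq_fun do rewrite expRN.
  apply: cvg_inv_pinfty; apply/cvgryPge => A; near=> k.
  have := expR_ge1Dx (log_level d gamma v (t k)); apply: le_trans.
  rewrite -lerBlDl; near: k; apply: cvgry_ge; exact: cvg_log_level.
apply: cvg_trans; apply: near_eq_cvg; near=> k.
have s0 : 0 < log_level d gamma v (t k).
  by near: k; apply: cvgry_gt; exact: cvg_log_level.
by rewrite /level -powRrM mulVf ?gt_eqF// powRr1// ltW.
Unshelve. all: by end_near. Qed.

Lemma le_log_level (v v' s : R) : 0 < v -> v <= v' ->
  log_level d gamma v' s <= log_level d gamma v s.
Proof.
by move=> v0 vv'; rewrite lerD2l lerN2 ler_ln// posrE (lt_le_trans v0).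
Qed.

(** The grid is v_j = (j + 1) eta, starting at eta so that ln v_j makes sense. All other sites must
    stay below the lower end of the j-th height interval, which belongs to v_(j+1); hence the factor
    j + 2. *)
Definition grid_sum (eta : R) (M : nat) (x : 'rV[R]_d) : R := \sum_(j < M)
  eta * expR (- (kappa * l1norm x)) * expR (- (lambda * (j.+2%:R * eta))).

Lemma near_grid_sum_le (eta : R) (M : nat) x (a : R) : 0 < eta ->
  a < grid_sum eta M x -> \forall k \near \oo, a < local_density k x.
Proof.
(* Capping the index at M leaves finitely many heights, so that eventual properties hold for all j
   simultaneously, as [argmax_ge] demands. *)
move=> eta0 aG; pose v (j : nat) : R := (minn j M).+1%:R * eta.
have v0 j : 0 < v j by rewrite mulr_gt0.
have vM j : v j <= v M by rewrite ler_wpM2r ?(ltW eta0)// ler_nat ltnS minnn geq_minr.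
have vnd i j : (i <= j)%N -> v i <= v j.
  move=> ij; rewrite ler_wpM2r ?(ltW eta0)// ler_nat ltnS leq_min geq_minr andbT.
  by rewrite (leq_trans (geq_minl _ _)).
pose u k j := level d gamma (v j) (t k).
pose N k j := mean_exceedances (v j) k.
pose L k := \sum_(j < M) (stail (v j.+1) k x - stail (v j) k x) *
  expR (- (N k j.+1 / (1 - weibull_tail gamma (u k j.+1)))).
have LG : L k @[k --> \oo] --> grid_sum eta M x.
  apply: cvg_big => [|j _]; first exact: add_continuous.
  have -> : eta * expR (- (kappa * l1norm x)) * expR (- (lambda * (j.+2%:R * eta))) =
      (v j.+1 * expR (- (kappa * l1norm x)) - v j * expR (- (kappa * l1norm x))) *
      expR (- (lambda * v j.+1 / (1 - 0))).
    rewrite subr0 divr1 -mulrBl; congr (_ * _ * _).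
      by rewrite /v (minn_idPl (ltn_ord j)) (minn_idPl (ltnW (ltn_ord j)))
        -mulrBl -natrB// subSnn mul1r.
    by rewrite /v (minn_idPl (ltn_ord j)).
  apply: cvgM; first by apply: cvgB; exact: cvg_scaled_tail_cell.
  apply: continuous_cvg; first exact: continuous_expR.
  apply: cvgN; apply: cvgM; first exact: cvg_mean_exceedances.
  apply: cvgV; first by rewrite subr0 oner_neq0.
  by apply: cvgB; [exact: cvg_cst|exact: cvg_level_tail].
have Nfin : \forall k \near \oo, forall j : 'I_M.+1,
    (\int[lebesgue_row R d]_x (stail (v j) k x)%:E)%E \is a fin_num.
  apply: filter_forall => j.
  by have /fine_cvgP[] := cvg_integral_scaled_tail hd gamma0 t_oo (v0 j).
near=> k.
have et : expR 1 < t k by near: k; exact: near_gte.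
have r0 := spatial_scale_gt0 gamma et.
have s0 j : 0 < log_level d gamma (v j) (t k).
  apply: (@lt_le_trans _ _ (log_level d gamma (v M) (t k))); last exact: le_log_level.
  by near: k; apply: cvgry_gt; exact: cvg_log_level.
have aL : a < L k by near: k; apply: (cvgr_gt (grid_sum eta M x)).
have Nk j : (\int[lebesgue_row R d]_x (stail (v j) k x)%:E)%E \is a fin_num.
  have -> : v j = v (inord (minn j M) : 'I_M.+1).
    by rewrite /v inordK ?ltnS ?geq_minr// -minnA minnn.
  by move: (inord _); near: k; exact: Nfin.
apply: (lt_le_trans aL).
have := @argmax_ge R d gamma gamma0 dO Omega P xi xi_indep xi_weibull Z Z_meas Z_max
  (t k) et M (u k) (N k) (cell (r (t k)) x).
have /fineK <- : P (Z (t k) @^-1` [set cell (r (t k)) x]) \is a fin_num.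
  by apply: fin_num_measure; exact: Z_meas.
rewrite lee_fin => h; rewrite /local_density.
have {}h := ler_wpM2l (exprn_ge0 d (ltW r0)) (h _ _ _).
apply: le_trans (h _ _ _).
- rewrite mulr_sumr; apply: ler_sum => j _.
  by rewrite mulrA mulrBr.
- by move=> j; exact: powR_gt0.
- move=> i j ij; apply: ge0_ler_powR; rewrite ?nnegrE ?(ltW (s0 _)) ?invr_ge0 ?(ltW gamma0)//.
  by apply: le_log_level => //; exact: vnd.
- move=> j J uJ; rewrite -lee_fin fineK//; exact: sum_exceedances_le.
Unshelve. all: by end_near. Qed.

Lemma lambda_gt0 : 0 < lambda.
Proof. by rewrite exprn_gt0// divr_gt0// limit_rate_gt0. Qed.

(** A geometric sum of ratio q = exp(- lambda eta): it contains eta / (1 - q), at least 1 / lambda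
    because 1 - q <= lambda eta. The losses are q^2 from the offset of the grid and 1 - q^M from its
    truncation. *)
Lemma grid_sum_ge (eta : R) (M : nat) x : 0 < eta ->
  expR (- (kappa * l1norm x)) / lambda *
    (expR (- (lambda * (2 * eta))) * (1 - expR (- (lambda * (M%:R * eta))))) <=
  grid_sum eta M x.
Proof.
move=> eta0; have l0 := lambda_gt0.
pose q := expR (- (lambda * eta)).
have qlt1 : q < 1 by rewrite expR_lt1 oppr_lt0 mulr_gt0.
have qX n : expR (- (lambda * (n%:R * eta))) = q ^+ n.
  by rewrite -expRM_natl; congr expR; ring.
have -> : grid_sum eta M x = eta * expR (- (kappa * l1norm x)) * q ^+ 2 *
    ((1 - q ^+ M) / (1 - q)).
  rewrite /grid_sum -mulr_sumr -[RHS]mulrA; congr (_ * _).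
  under eq_bigr do rewrite qX -addn2 exprD mulrC.
  rewrite -mulr_sumr; congr (_ * _).
  have := subrX1 q M; rewrite -opprB -[in X in _ = X]opprB mulNr => /oppr_inj ->.
  by rewrite mulrAC divff ?mul1r// subr_eq0 gt_eqF.
rewrite !qX; have q1 : 1 - q <= lambda * eta.
  by have := expR_ge1Dx (- (lambda * eta)); rewrite -/q; lra.
have q0 : 0 < 1 - q by rewrite subr_gt0.
have h : lambda^-1 <= eta / (1 - q).
  by rewrite ler_pdivlMr// ler_pdivrMl.
have qM : 0 <= 1 - q ^+ M by rewrite subr_ge0 exprn_ile1// ?expR_ge0 ?ltW.
have e0 := expR_gt0 (- (kappa * l1norm x)).
have -> : eta * expR (- (kappa * l1norm x)) * q ^+ 2 * ((1 - q ^+ M) / (1 - q)) =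
  expR (- (kappa * l1norm x)) * (q ^+ 2 * (1 - q ^+ M)) * (eta / (1 - q)) by ring.
by rewrite mulrAC ler_wpM2l// mulr_ge0 ?(ltW e0)// mulr_ge0// exprn_ge0// expR_ge0.
Qed.

Lemma local_limit x (a : R) : a < laplace_row_pdf kappa x ->
  \forall k \near \oo, a < local_density k x.
Proof.
have k0 : 0 < kappa by exact: limit_rate_gt0.
have l0 := lambda_gt0.
have -> : laplace_row_pdf kappa x = expR (- (kappa * l1norm x)) / lambda.
  rewrite laplace_row_pdfE mulrC; congr (_ * _).
  by rewrite /exceedance_rate -exprVn invf_div.
set p := _ / _ => ap.
(* Mesh 1/(n+1) with (n+1)^2 points: the mesh tends to 0 while the range n+1 tends to infinity, so
   both losses disappear. One n with a < G n is then fixed. *)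
pose G (n : nat) := p * (expR (- (lambda * (2 * n.+1%:R^-1))) *
  (1 - expR (- (lambda * ((n.+1 ^ 2)%:R * n.+1%:R^-1))))).
have noo : (n.+1%:R : R) @[n --> \oo] --> +oo.
  apply/cvgryPge => A; near=> n; apply: (@le_trans _ _ n%:R); last by rewrite ler_nat.
  by near: n; exact: nbhs_infty_ger.
have Gp : G n @[n --> \oo] --> p * (expR (- (lambda * (2 * 0))) * (1 - 0)).
  apply: cvgMl_tmp; apply: cvgM.
    apply: continuous_cvg; first exact: continuous_expR.
    by apply: cvgN; do 2 apply: cvgMl_tmp; exact: cvg_inv_pinfty.
  apply: cvgB; first exact: cvg_cst.
  have : (expR (lambda * n.+1%:R))^-1 @[n --> \oo] --> (0 : R).
    apply: cvg_inv_pinfty; apply/cvgryPge => A; near=> n.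
    apply: le_trans (expR_ge1Dx _); rewrite -lerBlDl -ler_pdivrMl//.
    by near: n; exact: cvgry_ge.
  apply: cvg_trans; apply: near_eq_cvg; near=> n.
  by rewrite -expRN; congr expR; rewrite natrX expr2 mulfK.
rewrite !mulr0 oppr0 expR0 addr0 !mulr1 in Gp.
have : \forall n \near \oo, a < G n by exact: (cvgr_gt p).
move=> [n _ /(_ n (leqnn n))/= aG].
apply: (@near_grid_sum_le n.+1%:R^-1 (n.+1 ^ 2)%N); first by rewrite invr_gt0.
by apply: (lt_le_trans aG); apply: grid_sum_ge; rewrite invr_gt0.
Unshelve. all: by end_near. Qed.

End local_limit.

(** * From local lower bounds to convergence in distribution *)

Lemma integral_probability_affine d (T : measurableType d) (R : realType)
    (P : probability T R) (f : T -> R) (M s : R) :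
  measurable_fun setT f -> (forall x, `|f x| <= M) ->
  (\int[P]_x (f x)%:E)%E \is a fin_num /\
  (\int[P]_x (M + s * f x)%:E = (M + s * fine (\int[P]_x (f x)%:E))%:E)%E.
Proof.
move=> mf fM.
have fi : P.-integrable setT (EFin \o f).
  apply: measurable_bounded_integrable => //.
    by rewrite (le_lt_trans (probability_le1 P measurableT))// ltry.
  by exists M; split; [exact: num_real|move=> x Mx y _ /=; rewrite (le_trans (fM y))// ltW].
have ffin : (\int[P]_x (f x)%:E)%E \is a fin_num by exact: integrable_fin_num.
split=> //; under eq_integral do rewrite EFinD EFinM.
rewrite integralD//; last 2 first.
- exact: finite_measure_integrable_cst.
- exact: integrableZl.
rewrite integralZl// (_ : (\int[P]_x M%:E)%E = M%:E); last first.
  rewrite (integral_cst P measurableT M%:E) [X in (_ * X)%E](_ : _ = 1%E) ?mule1//.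
  exact: probability_setT.
by rewrite -[X in (_ + _ * X)%E](fineK ffin) -EFinM -EFinD.
Qed.

(* If all nonnegative bounded continuous test functions satisfy the lower bound,
   applying it to [M + f] and [M - f] gives convergence. *)
Lemma cvg_of_liminf_bound d1 d2 (T1 : measurableType d1) (T2 : measurableType d2)
    (R : realType) (n : nat) (P : probability T1 R) (Q : probability T2 R)
    (X : nat -> T1 -> 'rV[R]_n) (Y : T2 -> 'rV[R]_n) :
  (forall f : 'rV[R]_n -> R, continuous f -> measurable_fun setT (f \o Y)) ->
  (\forall k \near \oo, forall f : 'rV[R]_n -> R, measurable_fun setT (f \o X k)) ->
  (forall (f : 'rV[R]_n -> R) (M e : R), continuous f -> (forall x, 0 <= f x <= M) -> 0 < e ->
    \forall k \near \oo,
      (\int[Q]_w (f (Y w))%:E - e%:E <= \int[P]_w (f (X k w))%:E)%E) ->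
  forall f : 'rV[R]_n -> R, continuous f -> (exists M, forall x, `|f x| <= M) ->
    ('E_P[f \o X k] @[k --> \oo] --> 'E_Q[f \o Y])%E.
Proof.
move=> mY mX low f cf [M fM]; rewrite unlock.
have Q_aff s := integral_probability_affine Q s (mY f cf) (fun w => fM (Y w)).
have cfs s : continuous (fun x => M + s * f x).
  by move=> x; exact: (cvgD (cvg_cst M) (cvgMl_tmp (a := s) (cf x))).
have bnd s : `|s| = 1 -> forall x, 0 <= M + s * f x <= M + M.
  move=> s1 x; have : `|s * f x| <= M by rewrite normrM s1 mul1r.
  by rewrite ler_norml => /andP[? ?]; apply/andP; split; lra.
rewrite -(fineK (Q_aff 1).1); apply/fine_cvgP; split.
  near=> k; have mXk : measurable_fun setT (f \o X k) by near: k; apply: filterS mX => k; exact.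
  by have [] := integral_probability_affine P 1 mXk (fun w => fM (X k w)).
apply/cvgrPdist_le => e e0.
have low1 := low _ _ _ (cfs 1) (bnd 1 (normr1 _)) e0.
have lowN := low _ _ _ (cfs (-1)) (bnd (-1) (normrN1 _)) e0.
near=> k; have mXk : measurable_fun setT (f \o X k) by near: k; apply: filterS mX => k; exact.
have P_aff s := integral_probability_affine P s mXk (fun w => fM (X k w)).
have : (\int[Q]_w (M + 1 * f (Y w))%:E - e%:E <= \int[P]_w (M + 1 * f (X k w))%:E)%E.
  by near: k; exact: low1.
have : (\int[Q]_w (M + -1 * f (Y w))%:E - e%:E <= \int[P]_w (M + -1 * f (X k w))%:E)%E.
  by near: k; exact: lowN.
rewrite /= (Q_aff 1).2 (Q_aff (-1)).2 (P_aff 1).2 (P_aff (-1)).2 -!EFinB !lee_fin.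
set q := fine _; set p := fine _ => h1 h2.
by rewrite ler_norml; apply/andP; split; move: h1 h2; rewrite /p /q /=; lra.
Unshelve. all: by end_near. Qed.

Section convergence.
Context (R : realType) (d : nat) (gamma : R) (hd : (1 <= d)%N) (gamma0 : 0 < gamma)
  (dO : measure_display) (Omega : measurableType dO) (P : probability Omega R)
  (xi : 'rV[int]_d -> {RV P >-> R})
  (xi_indep : mutually_independent P (fun z => xi z : Omega -> R))
  (xi_weibull : forall z, weibull_distributed P gamma (xi z))
  (Z : R -> Omega -> 'rV[int]_d)
  (Z_meas : forall t, expR 1 < t -> forall z, measurable (Z t @^-1` [set z]))
  (Z_max : forall t, expR 1 < t ->
      {ae P, forall w,
        (exists z, is_maximiser (Psi gamma (xi ^~ w) t) z) ->
        is_maximiser (Psi gamma (xi ^~ w) t) (Z t w)})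
  (t : R^nat) (t_oo : t @ \oo --> +oo).

Notation r := (spatial_scale gamma).
Notation kappa := (limit_rate d gamma).
Notation pdf := (@laplace_row_pdf R d kappa).

Let rescale k (z : 'rV[int]_d) : 'rV[R]_d := (r (t k))^-1 *: map_mx intr z.

(** The minimum is dominated by the integrable limit density and still bounds the local density from
    below. *)
Let rho k x := Num.min (local_density gamma P Z t k x) (pdf x).

Let pdf0 x : 0 <= pdf x.
Proof. by rewrite ltW// laplace_row_pdf_gt0// limit_rate_gt0. Qed.

Let rho_ge0 k x : 0 < r (t k) -> 0 <= rho k x.
Proof.
by move=> r0; rewrite le_min pdf0 andbT mulr_ge0 ?fine_ge0// exprn_ge0// ltW.
Qed.

Let measurable_rho k : 0 < r (t k) -> measurable_fun setT (rho k).
Proof.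
move=> r0; apply: measurable_minr; last exact: measurable_laplace_row_pdf.
exact: (@measurable_cell_comp _ _ _ _ k
  (fun z => r (t k) ^+ d * fine (P (Z (t k) @^-1` [set z])))).
Qed.

(** Over the cell of z, [rho] is at most r^d P(Z = z), and the cell has volume r^(-d). *)
Let integral_rho_le k (f : 'rV[R]_d -> R) : expR 1 < t k -> (forall x, 0 <= f x) ->
  (\int[lebesgue_row R d]_x (f (rescale k (cell (r (t k)) x)) * rho k x)%:E <=
   \int[P]_w (f (rescale k (Z (t k) w)))%:E)%E.
Proof.
move=> et f0; have r0 := spatial_scale_gt0 gamma et.
apply: (@ge0_le_integral_fibers _ _ _ _ _ _ (lebesgue_row R d) P (cell (r (t k)))
   (Z (t k)) (fun z => f (rescale k z)) (rho k)) => //.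
- by move=> z; exact: measurable_cell.
- exact: Z_meas.
- exact: measurable_rho.
- by move=> x; exact: rho_ge0.
move=> z; have mz : measurable (cell (r (t k)) @^-1` [set z]) by exact: measurable_cell.
apply: (@le_trans _ _ (\int[lebesgue_row R d]_(x in cell (r (t k)) @^-1` [set z])
    cst (r (t k) ^+ d * fine (P (Z (t k) @^-1` [set z])))%:E x)%E).
  apply: ge0_le_integral => //.
  - by move=> x _; rewrite lee_fin rho_ge0.
  - by apply/measurable_funTS/measurable_EFinP; exact: measurable_rho.
  - by move=> x /= <-; rewrite lee_fin ge_min lexx.
rewrite integral_cst; last exact: mz.
rewrite [X in (_ * X)%E](lebesgue_row_cell z r0) -EFinM mulrAC divff ?mul1r.
  by rewrite fineK// fin_num_measure//; exact: Z_meas.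
by rewrite gt_eqF// exprn_gt0.
Qed.

Let cvg_integral_rho (f : 'rV[R]_d -> R) (M : R) : continuous f ->
  (forall x, 0 <= f x <= M) ->
  (\int[lebesgue_row R d]_x (f (rescale k (cell (r (t k)) x)) * rho k x)%:E @[k --> \oo] -->
   \int[lebesgue_row R d]_x (f x * pdf x)%:E)%E.
Proof.
move=> cf fM; have roo : r (t k) @[k --> \oo] --> +oo by exact: cvg_spatial_scale.
have M0 : 0 <= M by have /andP[/le_trans] := fM 0; exact.
apply: (near_dominated_cvg (g := fun x => M * pdf x)).
- near=> k; have r0 : 0 < r (t k) by near: k; exact: cvgry_gt.
  split.
    apply: measurable_funM; last exact: measurable_rho.
    exact: (@measurable_cell_comp _ _ _ _ k (fun z => f (rescale k z))).
  move=> x; have /andP[f0 fle] := fM (rescale k (cell (r (t k)) x)).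
  rewrite ger0_norm; last by rewrite mulr_ge0// rho_ge0.
  by rewrite ler_pM// ?rho_ge0// ge_min lexx orbT.
- move=> x; apply: cvgM.
    by apply: (continuous_cvg _ (cf x)); exact: (cvg_cell (r := fun k => r (t k))).
  apply/cvgrPdist_le => e e0.
  (* As [rho] never exceeds the limit density, the one-sided local bound yields its convergence. *)
  have loc := @local_limit R d gamma hd gamma0 dO Omega P xi xi_indep xi_weibull
    Z Z_meas Z_max t t_oo x (pdf x - e).
  near=> k; rewrite ger0_norm ?subr_ge0 ?ge_min ?lexx ?orbT//.
  rewrite lerBlDr -lerBlDl le_min gerBl (ltW e0) andbT ltW//.
  by near: k; apply: loc; rewrite gtrBl.
- apply/integrableP; split.
    by apply/measurable_EFinP; apply: measurable_funM => //; exact: measurable_laplace_row_pdf.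
  rewrite (_ : (\int[_]_x _)%E = (\int[lebesgue_row R d]_x (M%:E * (pdf x)%:E))%E); last first.
    by apply: eq_integral => x _; rewrite abse_EFin ger0_norm ?mulr_ge0// EFinM.
  rewrite ge0_integralZl_EFin//.
  - by rewrite integral_laplace_row ?mule1 ?ltry// limit_rate_gt0.
  - by move=> x _; rewrite lee_fin.
  - by apply/measurable_EFinP; exact: measurable_laplace_row_pdf.
Unshelve. all: by end_near. Qed.

Lemma cvg_rescaled_argmax (Q : probability 'rV[R]_d R) (f : 'rV[R]_d -> R) :
  (forall A, measurable A -> Q A = (\int[lebesgue_row R d]_(x in A) (pdf x)%:E)%E) ->
  continuous f -> (exists M, forall x, `|f x| <= M) ->
  ('E_P[f \o (fun w => rescale k (Z (t k) w))] @[k --> \oo] --> 'E_Q[f \o id])%E.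
Proof.
move=> QE; move: f; apply: (cvg_of_liminf_bound (X := fun k w => rescale k (Z (t k) w))).
- by move=> f cf; exact: continuous_measurable_row.
- near=> k => f; have et : expR 1 < t k by near: k; exact: near_gte.
  exact: (measurable_countable_comp (Z_meas et)
    (fun z => f (rescale k z) : measurableTypeR R)).
move=> f M e cf fM e0.
have f0 x : 0 <= f x by have /andP[] := fM x.
have fM' x : `|f x| <= M by rewrite ger0_norm//; have /andP[] := fM x.
have [Qfin _] := integral_probability_affine Q 1 (continuous_measurable_row cf) fM'.
have := cvg_integral_rho cf fM.
rewrite -(ge0_integral_density (@measurable_laplace_row_pdf R d kappa) pdf0 QE
  (continuous_measurable_row cf) f0) -[in X in X -> _](fineK Qfin) => /fine_cvgP[Ifin Icvg].
near=> k; have et : expR 1 < t k by near: k; exact: near_gte.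
apply: le_trans (integral_rho_le et f0).
have /fineK <- : (\int[lebesgue_row R d]_x
    (f (rescale k (cell (r (t k)) x)) * rho k x)%:E)%E \is a fin_num by near: k; exact: Ifin.
rewrite -(fineK Qfin) -EFinB lee_fin.
near: k; apply: (cvgr_ge _ Icvg); by rewrite gtrBl.
Unshelve. all: by end_near. Qed.

End convergence.

(** * The limit theorem, realised on the canonical space of the limit law *)

Theorem theorem1p2 (R : realType) (d : nat) (hd : (1 <= d)%N)
    (gamma : R) (hgamma : 0 < gamma)
    (dO : measure_display) (Omega : measurableType dO) (P : probability Omega R)
    (xi : 'rV[int]_d -> {RV P >-> R})
    (xi_indep : mutually_independent P (fun z => xi z : Omega -> R))
    (xi_weibull : forall z, weibull_distributed P gamma (xi z))
    (Z : R -> Omega -> 'rV[int]_d)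
    (Z_meas : forall t, expR 1 < t ->
      forall z, measurable (Z t @^-1` [set z]))
    (Z_max : forall t, expR 1 < t ->
      {ae P, forall w,
        (exists z, is_maximiser (Psi gamma (xi ^~ w) t) z) ->
        is_maximiser (Psi gamma (xi ^~ w) t) (Z t w)}) :
  exists (dX : measure_display) (OmegaX : measurableType dX)
    (Q : probability OmegaX R) (X : {RV Q >-> 'rV[R]_d}),
    [/\ cvg_in_distribution P Q +oo
          (fun t w => (spatial_scale gamma t)^-1 *: map_mx intr (Z t w)) X,
        mutually_independent Q (fun i w => X w ord0 i),
        forall i,
          [/\ exponentially_distributed Q (limit_rate d gamma)
                 (fun w => `|X w ord0 i|),
              uniform_sign Q (fun w => Num.sg (X w ord0 i)) &
              mutually_independent Q (fun (b : bool) w =>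
                if b then Num.sg (X w ord0 i) else `|X w ord0 i|)] &
        has_density Q X (limit_density gamma)].
Proof.
have k0 : 0 < limit_rate d gamma by exact: limit_rate_gt0.
have [Q QE] := density_probability (@measurable_laplace_row_pdf R d (limit_rate d gamma))
  (fun x => ltW (laplace_row_pdf_gt0 k0 x)) (integral_laplace_row d k0).
(* The limit variable is the identity of R^d under the Laplace product law [Q]. *)
pose idM := isMeasurableFun.Build _ _ _ _ idfun (@measurable_id _ 'rV[R]_d setT).
pose X : {RV Q >-> 'rV[R]_d} := HB.pack_for {mfun 'rV[R]_d >-> 'rV[R]_d} idfun idM.
exists _, 'rV[R]_d, Q, X; split.
(* Convergence along real t -> +oo is tested on sequences tending to +oo. *)
- move=> f cf fb; apply/cvge_pinftyP => u u_oo.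
  exact: (cvg_rescaled_argmax hd hgamma xi_indep xi_weibull Z_meas Z_max u_oo QE).
- exact: laplace_row_independent k0 Q QE.
- move=> i; split.
  + by move=> A mA; exact: (laplace_row_norm k0 QE).
  + exact: (laplace_row_uniform_sign k0 QE).
  + exact: (laplace_row_sg_norm_independent k0 QE).
- move=> A mA; rewrite /X preimage_id QE//; apply: eq_integral => x _.
  congr (_%:E); rewrite laplace_row_pdfE /limit_density; congr (_ * _).
  (* The normalising constant (kappa / 2)^d is d^(d (1 - 1/gamma)) / 2^d. *)
  rewrite expr_div_n; congr (_ / _).
  by rewrite /limit_rate -powR_mulrn ?powR_ge0// -powRrM mulrC.
Qed.
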